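(* Let $n \ge d \ge 5$, let $u,v\in V(Q_n)$ be vertices of opposite parity, and let $M$ be a matching of $Q_n$ spanning at most $d$ directions. Assume the following property holds in dimension $d$: for every matching $M'$ of $Q_d$ and every two vertices $a,b\in V(Q_d)$ of opposite parity, there exist two distinct Hamilton paths of $Q_d$ between $a$ and $b$ containing all edges of $M'$ if and only if none of the conditions C1, C2, C3 (below, applied to $Q_d$, $M'$, $a$, $b$) holds. Then $M$ can be extended to a Hamilton path of $Q_n$ between $u$ and $v$ (i.e. there is a Hamilton path of $Q_n$ with endpoints $u,v$ containing all edges of $M$) if and only if none of the conditions C1, C2, C3 holds for $Q_n$, $M$, $u$, $v$.
   Context: $Q_n$ has vertex set $\{0,1\}^n$, two vertices adjacent iff they differ in exactly one coordinate; the parity of a vertex is the parity of its number of ones. The direction of edge $xy$ is the coordinate where $x,y$ differ; a matching spans at most $d$ directions if its edges lie in at most $d$ distinct directions. For a vertex $x$ and $i\in[n]$, $x^i$ denotes the vertex obtained by flipping coordinate $i$. A half-layer in direction $i$ is a set of the form $\{x x^i : x_i = 0,\ x \text{ has parity } p\}$ for a fixed parity $p$. For a vertex $u$, a $u$-avoiding almost half-layer in direction $i$ is $H\setminus\{uu^i\}$ where $H$ is the half-layer in direction $i$ containing $uu^i$. A vertex is covered by a set of edges if it is an endpoint of one of them. For a matching $M$ of $Q_n$ and vertices $u,v$ of opposite parity, the C-conditions are: C1: $M$ contains (as a subset) a half-layer $H$ and both $u$ and $v$ are covered by $H$. C2: there are directions $i\ne j$ such that $v=u^i$, $M$ contains the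 $u$-avoiding almost half-layer in direction $i$, and $uu^j\in M$ and $vv^j\in M$. C3: $uv\in M$. *)

(* Defs.v *)
From mathcomp Require Import all_boot.

Set Implicit Arguments.
Unset Strict Implicit.
Unset Printing Implicit Defensive.

Section Hypercube.
Variable n : nat.

Definition cube := {ffun 'I_n -> bool}.

Implicit Types (x y u v a b : cube) (i j : 'I_n) (p : bool).
Implicit Types (M H : {set {set cube}}) (s : seq cube).

Definition adj : rel cube := fun x y => #|[set i | x i != y i]| == 1.

Definition parity x : bool := odd #|[set i | x i]|.

Definition flip x i : cube := [ffun k => if k == i then ~~ x k else x k].

Definition edge_in x i : {set cube} := [set x; flip x i].

Definition cube_edges : {set {set cube}} :=
  [set e | [exists x, exists y, adj x y && (e == [set x; y])]].

Definition matching M : Prop := M \subset cube_edges /\ trivIset M.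

Definition directions M : {set 'I_n} :=
  [set i | [exists x, exists y,
    [&& adj x y, [set x; y] \in M & x i != y i]]].

Definition half_layer i p : {set {set cube}} :=
  [set edge_in x i | x in [set x : cube | ~~ x i & parity x == p]].

Definition covered x H : Prop := exists2 e, e \in H & x \in e.

(* The edge u u^i lies in exactly one of the two half-layers in direction i,
   so this relation determines A. *)
Definition almost_half_layer u i (A : {set {set cube}}) : Prop :=
  exists2 p, edge_in u i \in half_layer i p
           & A = half_layer i p :\ edge_in u i.

Definition condC1 M u v : Prop :=
  exists i p, [/\ half_layer i p \subset M,
                  covered u (half_layer i p) & covered v (half_layer i p)].

Definition condC2 M u v : Prop :=
  exists i j, [/\ i != j, v = flip u i,
    exists2 A, almost_half_layer u i A & A \subset M
    & edge_in u j \in M /\ edge_in v j \in M].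

Definition condC3 M u v : Prop := [set u; v] \in M.

(* A path is given by the list of its vertices, traversed from a to b. *)
Definition hamilton_path a b s : Prop :=
  [/\ head b s = a, last a s = b, sorted adj s, uniq s & forall x, x \in s].

Definition path_edges s : {set {set cube}} :=
  [set e in [seq [set z.1; z.2] | z <- zip s (behead s)]].

End Hypercube.

(* Main.v *)
(** Let [D] be a set of [d] directions containing those of the matching.  By induction
    on [F], every subcube with free directions [F] containing [D] has, unless one of the
    conditions C1-C3 holds in it, two distinct Hamilton paths that contain the matching;
    the case [F = D] is the hypothesis.  To add a direction [k], cut the subcube into two
    sides along [k], and write [x^k] for the vertex opposite to [x].

    - If [u] and [v] lie on different sides, join a path [u .. x] to a path [x^k .. v];
      the conditions exclude at most a half-cube of vertices [x], or the neighbours of an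
      end, on either side.
    - If they lie on one side and C1 or C2 holds there, the matching on that side is
      essentially a layer, so that the side is covered by two explicit paths [u .. x] and
      [y .. v]; a path [x^k .. y^k] joins them.
    - Otherwise take two Hamilton paths [P] of the side of [u] and [v].  An unmatched edge
      [xy] of [P] can be replaced by a path [x^k .. y^k] unless [x^k y^k] is matched or C2
      holds for it.  If [x^k y^k] is matched for every such edge of both paths, they
      alternate between two matchings, which forces them to be equal.  If C2 holds
      for some [x^k y^k], the other side is essentially a layer, and it is covered by an
      explicit path [x^k .. y^k] together with one matched edge [z^k w^k], where [zw] is
      another edge of [P].

    Conversely, if C1 or C2 holds, counting on the side of [u] in the direction [i] of the
    half-layer shows that a Hamilton path containing the matching would leave no room for
    [u] (C1), or would contain all edges of the layer but [uv] and hence close up after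
    four vertices (C2). *)

Require Import Defs.
From mathcomp Require Import all_boot zify.

Set Implicit Arguments.
Unset Strict Implicit.
Unset Printing Implicit Defensive.

Local Notation "x ^! i" := (flip x i) (at level 29, left associativity).

(** * Flips, parity, classes and subcubes *)

Section Cube.
Variable n : nat.
Implicit Types (x y z u v w a b c : cube n) (i j k l t : 'I_n).
Implicit Types (F : {set 'I_n}).

Lemma flipE x i k : (x ^! i) k = x k (+) (k == i).
Proof. by rewrite ffunE; case: eqP => _; rewrite ?addbT ?addbF. Qed.

Lemma flipK x i : x ^! i ^! i = x.
Proof. by apply/ffunP=> k; rewrite !flipE -addbA addbb addbF. Qed.

Lemma flipC x i j : x ^! i ^! j = x ^! j ^! i.
Proof. by apply/ffunP=> k; rewrite !flipE addbAC. Qed.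

Lemma flip_inj i : injective (fun x => x ^! i).
Proof. by apply: (can_inj (g := fun x => x ^! i)) => x; rewrite flipK. Qed.

Lemma flip_dir x i j : x ^! i = x ^! j -> i = j.
Proof.
move/ffunP/(_ i); rewrite !flipE eqxx => /addbI /esym H.
by apply/eqP.
Qed.

Lemma flip_neq x i : x ^! i != x.
Proof. by apply/eqP => /ffunP/(_ i); rewrite flipE eqxx; case: (x i). Qed.

Lemma parity_big x : parity x = \big[addb/false]_k x k.
Proof.
rewrite /parity -sum1_card big_mkcond (big_morph odd oddD (erefl _)).
by apply: eq_bigr => k _; rewrite inE; case: (x k).
Qed.

Lemma parity_flip x i : parity (x ^! i) = ~~ parity x.
Proof.
rewrite !parity_big (eq_bigr (fun k => x k (+) (k == i))); last first.
  by move=> k _; rewrite flipE.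
rewrite big_split /= (bigD1 i) //= [X in _ (+) X](bigD1 i) //=.
rewrite eqxx [X in _ (+) (_ (+) X)]big1 ?addbT //.
by move=> k /negPf.
Qed.

Lemma adjP x y : reflect (exists i, y = x ^! i) (adj x y).
Proof.
apply: (iffP cards1P) => [[i /setP H]|[i ->]]; exists i.
  apply/ffunP=> k; move: (H k); rewrite !inE flipE => <-.
  by case: (x k); case: (y k).
apply/setP=> k; rewrite !inE flipE.
by case: (k == i); case: (x k).
Qed.

Lemma adj_flip x i : adj x (x ^! i).
Proof. by apply/adjP; exists i. Qed.

Lemma adj_flipr x i : adj (x ^! i) x.
Proof. by apply/adjP; exists i; rewrite flipK. Qed.

Lemma neq_coord x y : x != y -> exists i, x i != y i.
Proof.
move=> /eqP H; apply/existsP; apply: contraT; rewrite negb_exists => /forallP E.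
by case: H; apply/ffunP=> k; move: (E k); rewrite negbK => /eqP.
Qed.

(* The endpoints of the edges of a half-layer in direction [i] are the vertices
   of one class: a half-layer of parity [p] has class [p]. *)
Definition cls i x := parity x (+) x i.

Lemma cls_flip_same i x : cls i (x ^! i) = cls i x.
Proof. by rewrite /cls parity_flip flipE eqxx; case: parity; case: (x i). Qed.

Lemma cls_flip i j x : i != j -> cls i (x ^! j) = ~~ cls i x.
Proof.
by move=> /negPf ij; rewrite /cls parity_flip flipE ij addbF addNb.
Qed.

(** Lets C1, for ends of opposite parity, be decided by comparing a single coordinate. *)
Lemma cls_eq i x y : parity x != parity y -> (cls i x == cls i y) = (x i != y i).
Proof. by rewrite /cls; case: (parity x); case: (parity y); case: (x i); case: (y i). Qed.

(** A subcube with free directions [F] is named by any of its vertices [c], so that its two sides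
    along [k] are the subcubes of [F :\ k] through [c] and through [c ^! k]. *)
Definition subc F c : pred (cube n) :=
  fun z => [forall t, (t \notin F) ==> (z t == c t)].

Lemma subcP F c z : reflect (forall t, t \notin F -> z t = c t) (subc F c z).
Proof.
apply: (iffP forallP) => H t; first by move=> tF; move: (H t); rewrite tF => /eqP.
by apply/implyP => tF; apply/eqP/H.
Qed.

Lemma subc_refl F c : subc F c c.
Proof. exact/subcP. Qed.

Lemma subc_sym F c z : subc F c z = subc F z c.
Proof. by apply/subcP/subcP => H t tF; rewrite H. Qed.

Lemma subc_trans F a b c : subc F a b -> subc F b c -> subc F a c.
Proof. by move=> /subcP H /subcP K; apply/subcP=> t tF; rewrite K ?H. Qed.

Lemma subc_eql F a b : subc F a b -> subc F a =1 subc F b.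
Proof.
move=> H z; apply/idP/idP; apply: subc_trans => //.
by rewrite subc_sym.
Qed.

Lemma subc_flip F c z t : t \in F -> subc F c (z ^! t) = subc F c z.
Proof.
move=> tF; apply/subcP/subcP => H s sF; move: (H s sF); rewrite flipE.
all: by case: eqP => [E|_]; rewrite ?addbF // E tF in sF *.
Qed.

Lemma subc_flipl F c t : t \in F -> subc F (c ^! t) =1 subc F c.
Proof. by move=> tF z; rewrite subc_sym subc_flip // subc_sym. Qed.

Lemma subc_flip2 F c z t : subc F (c ^! t) (z ^! t) = subc F c z.
Proof.
by apply/subcP/subcP => H s sF; move: (H s sF); rewrite !flipE; [move/addIb|move->].
Qed.

Lemma subc_D1 F c z k : subc (F :\ k) c z = subc F c z && (z k == c k).
Proof.
apply/subcP/andP => [H|[/subcP H /eqP K] t].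
  split; last by apply/eqP/H; rewrite !inE eqxx.
  by apply/subcP=> t tF; apply: H; rewrite !inE negb_and tF orbT.
by rewrite !inE negb_and negbK => /orP[/eqP->|]//; apply: H.
Qed.

(** Stated between numbers, so that it adds up multiplicities when paths of the two sides are
    joined. *)
Lemma subc_split F c z k : k \in F ->
  (subc F c z : nat) = subc (F :\ k) c z + subc (F :\ k) (c ^! k) z.
Proof.
move=> kF; rewrite !subc_D1 subc_flipl // flipE eqxx.
by case: subc; case: (z k); case: (c k).
Qed.

Lemma subc0 c z : subc set0 c z = (z == c).
Proof.
apply/subcP/eqP => [H|->//]; apply/ffunP=> t; apply: H; by rewrite inE.
Qed.

Lemma subc_D1_sub F c z k : subc (F :\ k) c z -> subc F c z.
Proof. by rewrite subc_D1 => /andP[]. Qed.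

Lemma subc_D1I F c z k : subc F c z -> z k = c k -> subc (F :\ k) c z.
Proof. by rewrite subc_D1 => -> ->; rewrite eqxx. Qed.

Lemma subc_dir F c z t : subc F c z -> z t != c t -> t \in F.
Proof. by move=> /subcP H; apply: contraR => /H ->. Qed.

End Cube.

(** * Consecutive entries of a list *)

Section Consecutive.
Variable T : eqType.
Implicit Types (s q : seq T) (a b c x y : T).

Definition nx s a b := (a, b) \in zip s (behead s).
Definition lnk s a b := nx s a b || nx s b a.

Lemma lnkC s a b : lnk s a b = lnk s b a.
Proof. exact: orbC. Qed.

Lemma nx_cons2 s x y a b :
  nx (x :: y :: s) a b = ((a == x) && (b == y)) || nx (y :: s) a b.
Proof. by rewrite /nx /= inE. Qed.

Lemma nx_cat s1 x s2 a b :
  nx (s1 ++ x :: s2) a b = nx (rcons s1 x) a b || nx (x :: s2) a b.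
Proof.
elim: s1 => [|y [|z s1] IH] //.
  by rewrite /= !nx_cons2 /= orbF.
by rewrite /= !nx_cons2 in IH *; rewrite IH orbA.
Qed.

Lemma nxP s a b : reflect (exists s1 s2, s = s1 ++ a :: b :: s2) (nx s a b).
Proof.
apply: (iffP idP) => [|[s1 [s2 ->]]]; last by rewrite nx_cat nx_cons2 !eqxx orbT.
elim: s => [|x [|y s] IH] //.
rewrite nx_cons2 => /orP[/andP[/eqP-> /eqP->]|/IH[s1 [s2 ->]]].
  by exists [::], s.
by exists (x :: s1), s2.
Qed.

Lemma nx_mono s1 s2 s a b : nx s a b -> nx (s1 ++ s ++ s2) a b.
Proof.
move=> /nxP[p [q ->]]; apply/nxP; exists (s1 ++ p), (q ++ s2).
by rewrite -!catA.
Qed.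

Lemma nx_catl s1 s2 a b : nx s1 a b -> nx (s1 ++ s2) a b.
Proof. exact: (@nx_mono [::]). Qed.

Lemma nx_catr s1 s2 a b : nx s2 a b -> nx (s1 ++ s2) a b.
Proof. by move/(@nx_mono s1 [::]); rewrite cats0. Qed.

Lemma lnk_mono s1 s2 s a b : lnk s a b -> lnk (s1 ++ s ++ s2) a b.
Proof. by case/orP => /(nx_mono s1 s2) H; rewrite /lnk H ?orbT. Qed.

Lemma lnk_catl s1 s2 a b : lnk s1 a b -> lnk (s1 ++ s2) a b.
Proof. exact: (@lnk_mono [::]). Qed.

Lemma lnk_catr s1 s2 a b : lnk s2 a b -> lnk (s1 ++ s2) a b.
Proof. by move/(@lnk_mono s1 [::]); rewrite cats0. Qed.

Lemma nx_index s a b : uniq s -> nx s a b ->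
  [/\ a \in s, b \in s & index b s = (index a s).+1].
Proof.
move=> us /nxP[s1 [s2 E]]; rewrite E in us *.
move: us; rewrite cat_uniq /= !inE !negb_or => /and3P[_ /and3P[a1 b1 _] /andP[/andP[ab _] _]].
rewrite !mem_cat !inE !eqxx !orbT; split=> //.
by rewrite !index_cat (negPf a1) (negPf b1) /= !eqxx (negPf ab) addn0 addn1.
Qed.

Lemma nx_funr s a b c : uniq s -> nx s a b -> nx s a c -> b = c.
Proof.
move=> us /(nx_index us)[_ bs ib] /(nx_index us)[_ cs ic].
by rewrite -(nth_index b bs) -(nth_index b cs) ib ic.
Qed.

Lemma nx_funl s a b c : uniq s -> nx s a b -> nx s c b -> a = c.
Proof.
move=> us /(nx_index us)[as_ _ ib] /(nx_index us)[cs _ ic].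
by rewrite -(nth_index a as_) -(nth_index a cs); congr nth; apply: succn_inj; rewrite -ib.
Qed.

Lemma nx_asym s a b : uniq s -> nx s a b -> ~~ nx s b a.
Proof.
move=> us /(nx_index us)[_ _ ib]; apply/negP=> /(nx_index us)[_ _ ia].
by move: (leqnSn (index b s)); rewrite -ia ib ltnn.
Qed.

(** Each neighbour is the successor or the predecessor of [a], so two of the three coincide. *)
Lemma lnk_le2 s a b1 b2 b3 : uniq s -> lnk s a b1 -> lnk s a b2 -> lnk s a b3 ->
  b1 != b2 -> b1 != b3 -> b2 = b3.
Proof.
move=> us /orP[] h1 /orP[] h2 /orP[] h3 n2 n3.
all: by [ rewrite (nx_funr us h1 h2) eqxx in n2 | rewrite (nx_funl us h1 h2) eqxx in n2
  | rewrite (nx_funr us h1 h3) eqxx in n3 | rewrite (nx_funl us h1 h3) eqxx in n3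
  | apply: nx_funr us h2 h3 | apply: nx_funl us h2 h3 ].
Qed.

Lemma lnk_head s u a b : uniq (u :: s) -> lnk (u :: s) u a -> lnk (u :: s) u b -> a = b.
Proof.
move=> us.
have N c : nx (u :: s) c u = false.
  by apply/negP=> /(nx_index us)[_ _]; rewrite /= eqxx.
by rewrite /lnk !N !orbF; exact: nx_funr.
Qed.

Lemma lnk_last s u a b : uniq (u :: s) ->
  lnk (u :: s) (last u s) a -> lnk (u :: s) (last u s) b -> a = b.
Proof.
move=> us.
have N c : nx (u :: s) (last u s) c = false.
  apply/negP=> /(nx_index us)[_ cs ic]; move: cs; rewrite -index_mem ic.
  by rewrite index_last //= ltnn.
by rewrite /lnk !N /=; exact: nx_funl.
Qed.

Lemma nx_interior s0 s u z : s0 = u :: s -> z \in s0 -> z != u -> z != last u s ->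
  exists a b, nx s0 a z /\ nx s0 z b.
Proof.
move=> E zs zu; case/splitPr: zs E => p1 p2.
case: p1 => [[E]|u' p1 [E <-]]; first by rewrite E eqxx in zu.
rewrite last_cat /=; case: p2 => [|b p2]; first by rewrite eqxx.
rewrite {}E in zu * => _; exists (last u p1), b; split; last first.
  by apply/nxP; exists (u :: p1), p2.
apply/nxP; exists (belast u p1), (b :: p2).
by rewrite -[RHS]cat_rcons -lastI.
Qed.

(** Connectedness of a path: membership in [A] passes from each entry to the next. *)
Lemma closed_lnk s u (A : pred T) : A u ->
  (forall a b, A a -> lnk (u :: s) a b -> A b) -> {subset u :: s <= A}.
Proof.
elim: s u => [|y s IH] u Au cl z; first by rewrite inE => /eqP->.
rewrite inE => /orP[/eqP->//|]; apply: (IH y).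
  by apply: cl Au _; rewrite /lnk nx_cons2 !eqxx.
by move=> a b Aa L; apply: cl Aa _; move: L; rewrite /lnk !nx_cons2 => /orP[]->; rewrite !orbT.
Qed.

End Consecutive.

(** * Lists enumerating a set once, described by multiplicities *)

Section Counting.
Variables (T : eqType) (A : pred T) (s : seq T).
Hypothesis cA : forall z, count_mem z s = A z.

Lemma count_pred_mem z : (z \in s) = A z.
Proof. by rewrite -has_pred1 has_count cA lt0b. Qed.

Lemma count_pred_uniq : uniq s.
Proof. by apply: count_mem_uniq => z; rewrite count_pred_mem cA. Qed.

End Counting.

(** * Hamilton paths of a subcube that contain a matching *)

Section Paths.
Variable n : nat.
Implicit Types (x y z u v w a b c : cube n) (i j k l t : 'I_n).
Implicit Types (F : {set 'I_n}) (s q : seq (cube n)) (m : cube n -> 'I_n -> bool).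

Definition pth a b s :=
  if s is c :: s' then [&& c == a, path (@adj n) a s' & last a s' == b] else false.

Lemma pthP a b s :
  reflect (exists s', [/\ s = a :: s', path (@adj n) a s' & last a s' = b]) (pth a b s).
Proof.
apply: (iffP idP) => [|[s' [-> p l]]] /=; last by rewrite eqxx p l eqxx.
by case: s => //= c s /and3P[/eqP-> p /eqP l]; exists s.
Qed.

Lemma pth_cat a b c e s q : pth a b s -> pth c e q -> adj b c -> pth a e (s ++ q).
Proof.
move=> /pthP[s' [-> p l]] /pthP[q' [-> p' l']] bc; apply/pthP; exists (s' ++ c :: q').
by rewrite cat_path last_cat /= p l bc p' l'.
Qed.

Lemma pth_split a b s1 x y s2 : pth a b (s1 ++ x :: y :: s2) ->
  [/\ pth a x (rcons s1 x), pth y b (y :: s2) & adj x y].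
Proof.
case: s1 => [|c s1] /=; first by move/and3P=> [/eqP-> /andP[axy ->] ->]; rewrite !eqxx.
rewrite cat_path last_cat rcons_path last_rcons /= !eqxx.
by move=> /and3P[-> /and4P[-> -> -> ->] ->].
Qed.

Lemma pth_splice a b s1 x y s2 x' y' q : pth a b (s1 ++ x :: y :: s2) ->
  pth x' y' q -> adj x x' -> adj y' y -> pth a b (s1 ++ x :: q ++ y :: s2).
Proof.
move=> /pth_split[h1 h2 _] hq ax ay; rewrite -cat_rcons.
by apply: pth_cat h1 _ ax; apply: pth_cat hq h2 ay.
Qed.

Lemma pth_cons a b c s : adj a c -> pth c b s -> pth a b (a :: s).
Proof. by move=> ac h; apply: (@pth_cat a a c b [:: a]) => //=; rewrite !eqxx. Qed.

Lemma nx_splice s1 x y s2 q a b : nx (s1 ++ x :: y :: s2) a b ->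
  (a, b) != (x, y) -> nx (s1 ++ x :: q ++ y :: s2) a b.
Proof.
rewrite nx_cat nx_cons2 -pair_eqE /= => /orP[|/orP[->//|]] h _.
  by rewrite -cat_rcons nx_catl.
by rewrite -cat_rcons catA nx_catr.
Qed.

Lemma lnk_splice s1 x y s2 q a b : lnk (s1 ++ x :: y :: s2) a b ->
  (a, b) != (x, y) -> (b, a) != (x, y) -> lnk (s1 ++ x :: q ++ y :: s2) a b.
Proof. by move=> /orP[] h h1 h2; apply/orP; [left|right]; apply: nx_splice. Qed.

Lemma count_splice s1 x y s2 q z : count_mem z (s1 ++ x :: q ++ y :: s2) =
  count_mem z (s1 ++ x :: y :: s2) + count_mem z q.
Proof. by rewrite /= !count_cat /= count_cat /=; lia. Qed.

Lemma lnk_splice_new s1 x y s2 q a b : lnk q a b -> lnk (s1 ++ x :: q ++ y :: s2) a b.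
Proof. by move=> h; rewrite -cat_rcons; apply: lnk_mono. Qed.

Lemma nx_adj a b s x y : pth a b s -> nx s x y -> adj x y.
Proof. by move=> h /nxP[s1 [s2 E]]; move: h; rewrite E => /pth_split[]. Qed.

Lemma pth_interior a b s z : pth a b s -> z \in s -> z != a -> z != b ->
  exists x y, nx s x z /\ nx s z y.
Proof. by move=> /pthP[s' [E _ <-]]; apply: nx_interior. Qed.

(* [m z t] means that the edge between [z] and [z ^! t] is in the matching. *)
Definition HPm m F a b s :=
  [/\ pth a b s, forall z, count_mem z s = subc F a z
    & forall z t, subc F a z -> m z t -> lnk s z (z ^! t)].

Lemma HPm_uniq m F a b s : HPm m F a b s -> uniq s.
Proof. by case=> _ /count_pred_uniq. Qed.

Lemma HPm_mem m F a b s z : HPm m F a b s -> (z \in s) = subc F a z.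
Proof. by case=> _ /count_pred_mem->. Qed.

Lemma HPm_end m F a b s : HPm m F a b s -> subc F a b.
Proof.
move=> h; rewrite -(HPm_mem _ h); case: h => /pthP[s' [-> _ <-]] _ _.
exact: mem_last.
Qed.

(** No matched edge has direction [k], so every matched edge lies within one side and is kept by the
    path of that side. *)
Lemma HPm_cat m F k a b e s q : k \in F -> (forall z, m z k = false) ->
  HPm m (F :\ k) a b s -> HPm m (F :\ k) (b ^! k) e q -> HPm m F a e (s ++ q).
Proof.
move=> kF mk hs [pq cq lq]; have ab := HPm_end hs; case: hs => ps cs ls.
have E z : subc (F :\ k) (b ^! k) z = subc (F :\ k) (a ^! k) z.
  by apply/esym/subc_eql; rewrite subc_flip2.
split; first exact: pth_cat ps pq (adj_flip _ _).
  by move=> z; rewrite count_cat cs cq E -subc_split.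
move=> z t zF mt; have tk : t != k by apply: contraTneq mt => ->; rewrite mk.
have: subc (F :\ k) a z || subc (F :\ k) (a ^! k) z.
  by move: (subc_split a z kF); rewrite zF; case: subc; case: subc.
by case/orP => h; [apply/lnk_catl/ls|apply/lnk_catr/lq; rewrite ?E].
Qed.

(** The detour through the other side costs only the edge [xy], which is unmatched by [mxy]. *)
Lemma HPm_splice m F k a b s1 x y s2 q : k \in F -> (forall z, m z k = false) ->
  (forall t, y = x ^! t -> m x t = false) -> (forall z t, m (z ^! t) t = m z t) ->
  HPm m (F :\ k) a b (s1 ++ x :: y :: s2) -> HPm m (F :\ k) (x ^! k) (y ^! k) q ->
  HPm m F a b (s1 ++ x :: q ++ y :: s2).
Proof.
move=> kF mk mxy ms hs [pq cq lq].
have ax : subc (F :\ k) a x by rewrite -(HPm_mem _ hs) mem_cat !inE eqxx orbT.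
case: hs => ps cs ls.
have E z : subc (F :\ k) (x ^! k) z = subc (F :\ k) (a ^! k) z.
  by apply/esym/subc_eql; rewrite subc_flip2.
split; first exact: pth_splice ps pq (adj_flip _ _) (adj_flipr _ _).
  by move=> z; rewrite count_splice cs cq E -subc_split.
move=> z t zF mt.
have: subc (F :\ k) a z || subc (F :\ k) (a ^! k) z.
  by move: (subc_split a z kF); rewrite zF; case: subc; case: subc.
case/orP => h; last by apply/lnk_splice_new/lq; rewrite ?E.
apply: lnk_splice (ls _ _ h mt) _ _; apply/eqP => -[e1 e2].
  by move: (mxy t); rewrite -e1 -e2 mt => /(_ erefl).
by move: (mxy t); rewrite -e1 -e2 flipK ms mt => /(_ erefl).
Qed.

(** * Hamilton paths containing all edges of one direction *)

Definition layer i : cube n -> 'I_n -> bool := fun _ t => t == i.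

Lemma HPm_layer1 i u : HPm (layer i) [set i] u (u ^! i) [:: u; u ^! i].
Proof.
have S z : (subc [set i] u z : nat) = (z == u) + (z == u ^! i).
  by rewrite (@subc_split _ _ _ _ i) ?set11 // setDv !subc0.
split.
- by rewrite /= !eqxx adj_flip.
- by move=> z; rewrite S /= addn0 ![_ == z]eq_sym.
- move=> z t /[swap] /eqP->; move: (S z); case: subc => //.
  rewrite /lnk !nx_cons2 orbF; case: eqP => [->|_] /=; first by rewrite !eqxx.
  by case: eqP => // ->; rewrite flipK !eqxx.
Qed.

Lemma card_gt1_pick (F : {set 'I_n}) i : F != [set i] -> i \in F -> exists2 j, j \in F & j != i.
Proof.
move=> h iF; case: (pickP [pred j in F | j != i]) => [j /andP[]|no]; first by exists j.
case/eqP: h; apply/setP=> j; rewrite !inE; move: (no j) => /=.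
by case: eqP => [->|_]; rewrite ?iF ?andbT.
Qed.

Lemma layer_D1 i k : k != i -> forall z, layer i z k = false.
Proof. by move=> /negPf h z. Qed.

Lemma HPm_layer2 i j u F : i != j -> F = [set i; j] ->
  HPm (layer i) F u (u ^! j) [:: u; u ^! i; u ^! i ^! j; u ^! j].
Proof.
move=> ij EF; have F1 : F :\ j = [set i].
  rewrite EF; apply/setP=> t; rewrite !inE.
  by case: (eqVneq t j) => [->|]; rewrite ?andbF ?orbF // eq_sym (negPf ij).
have jF : j \in F by rewrite EF !inE eqxx orbT.
have ji: j != i by rewrite eq_sym.
have h1 := HPm_layer1 i u; have h2 := HPm_layer1 i (u ^! i ^! j).
have e : u ^! i ^! j ^! i = u ^! j by rewrite flipC flipK.
rewrite -F1 e in h1 h2.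
exact: HPm_cat jF (layer_D1 ji) h1 h2.
Qed.

(** Cut along a direction [l] other than [i] in which [u] and [x] differ: a path from [u] to
    [u ^! j] on one side continues from [u ^! j ^! l] to [x] on the other, and both pairs of ends
    again agree at [i] and have opposite parity. The recursion ends with three edges of a square. *)
Lemma layer_path i F u x : i \in F -> subc F u x -> parity u != parity x -> u i = x i ->
  exists s, HPm (layer i) F u x s.
Proof.
move: {2}#|F| (leqnn #|F|) => N; elim: N F u x => [|N IH] F u x.
  by rewrite leqn0 cards_eq0 => /eqP->; rewrite inE.
move=> FN iF ux pux iux.
have /neq_coord[l ul] : u != x by apply: contraNneq pux => ->.
have lF : l \in F by apply: subc_dir ux _; rewrite eq_sym.
have li : l != i by apply: contraNneq ul => ->; rewrite iux.
have iF' : i \in F :\ l by rewrite !inE eq_sym li.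
have FN' : #|F :\ l| <= N by move: FN; rewrite (cardsD1 l) lF.
have ux' : subc (F :\ l) (u ^! l) x.
  by apply: subc_D1I; rewrite ?subc_flipl // flipE eqxx; case: (u l) ul; case: (x l).
case: (eqVneq (F :\ l) [set i]) => [E|NE].
  have Fil : F = [set i; l] by rewrite -(setD1K lF) E setUC.
  have -> : x = u ^! l.
    apply/ffunP=> t; move/subcP: ux' => /(_ t); rewrite E inE; case: (eqVneq t i) => [->|_ ->//] _.
    by rewrite -iux flipE eq_sym (negPf li) addbF.
  by eexists; apply: HPm_layer2 Fil; rewrite eq_sym.
have [j jF ji] := card_gt1_pick NE iF'.
have [jl jF0]: j != l /\ j \in F by move: jF; rewrite !inE => /andP.
have [s1 h1] : exists s, HPm (layer i) (F :\ l) u (u ^! j) s.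
  apply: IH => //; first by rewrite subc_flip // subc_refl.
    by rewrite parity_flip; case: parity.
  by rewrite flipE eq_sym (negPf ji) addbF.
have [s2 h2] : exists s, HPm (layer i) (F :\ l) (u ^! j ^! l) x s.
  apply: IH => //; first by rewrite flipC subc_flipl.
    by rewrite !parity_flip negbK.
  by rewrite !flipE iux ![i == _]eq_sym (negPf ji) (negPf li) !addbF.
by exists (s1 ++ s2); apply: HPm_cat lF (layer_D1 li) h1 h2.
Qed.

(** Forcing the start around a square allows the C2 case to cut the path open there. The induction
    cuts along [l] and, on the side of [u], aims at a neighbour [u ^! q] until only the directions
    [i] and [j] remain. *)
Lemma layer_path2 i j l F u y : i \in F -> j \in F -> l \in F -> i != j -> l != i -> l != j ->
  subc F u y -> parity u != parity y -> u i = y i -> u l != y l ->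
  exists r, HPm (layer i) F u y [:: u, u ^! i, u ^! i ^! j, u ^! j & r].
Proof.
move: {2}#|F| (leqnn #|F|) => N; elim: N F l u y => [|N IH] F l u y.
  by rewrite leqn0 cards_eq0 => /eqP->; rewrite inE.
move=> FN iF jF lF ij li lj uy puy iuy ul.
have iF' : i \in F :\ l by rewrite !inE eq_sym li.
have jF' : j \in F :\ l by rewrite !inE eq_sym lj.
have FN' : #|F :\ l| <= N by move: FN; rewrite (cardsD1 l) lF.
have uy' : subc (F :\ l) (u ^! l) y.
  by apply: subc_D1I; rewrite ?subc_flipl // flipE eqxx; case: (u l) ul; case: (y l).
suff [y0 [r [ly0 sy0 py0 h1]]] : exists y0 r,
    [/\ y0 i = u i, subc (F :\ l) u y0, parity y0 != parity u &
    HPm (layer i) (F :\ l) u y0 [:: u, u ^! i, u ^! i ^! j, u ^! j & r]].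
  have [s2 h2] : exists s, HPm (layer i) (F :\ l) (y0 ^! l) y s.
    apply: layer_path => //.
    - by rewrite -(subc_eql (a := u ^! l)) // subc_flip2.
    - by rewrite parity_flip; case: (parity y0) (parity u) (parity y) py0 puy => [] [] [].
    - by rewrite flipE ly0 iuy eq_sym (negPf li) addbF.
  by exists (r ++ s2); apply: (HPm_cat lF (layer_D1 li) h1 h2).
case: (eqVneq (F :\ l) [set i; j]) => [E|NE].
  exists (u ^! j), [::]; split; last exact: HPm_layer2.
  - by rewrite flipE (negPf ij) addbF.
  - by rewrite subc_flip // subc_refl.
  - by rewrite parity_flip; case: parity.
have [q /andP[qF qij]] : exists q : 'I_n, (q \in F :\ l) && (q \notin [set i; j]).
  apply/existsP; apply: contraR NE; rewrite negb_exists => /forallP H.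
  apply/eqP/setP=> t; move: (H t); rewrite negb_and negbK.
  case: (boolP (t \in F :\ l)) => /= [_ ->//|h _]; apply/esym/negbTE.
  by apply: contra h; rewrite in_set2 => /orP[]/eqP->.
have [qi qj] : q != i /\ q != j by move: qij; rewrite !inE negb_or => /andP.
have iq : u i = (u ^! q) i by rewrite flipE eq_sym (negPf qi) addbF.
have sq : subc (F :\ l) u (u ^! q) by rewrite subc_flip // subc_refl.
have pq : parity u != parity (u ^! q) by rewrite parity_flip; case: parity.
have [|r h] := IH (F :\ l) q u (u ^! q) FN' iF' jF' qF ij qi qj sq pq iq.
  by rewrite flipE eqxx; case: (u q).
by exists (u ^! q), r; split=> //; rewrite eq_sym.
Qed.
End Paths.

(** * Paths along a layer that leave out a square *)

Section Ring.
Variable n : nat.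
Implicit Types (x y z u v w a b c : cube n) (i j k l t q : 'I_n).
Implicit Types (F : {set 'I_n}) (s r : seq (cube n)) (m : cube n -> 'I_n -> bool).

(** The path leaves out the square at [x] with directions [i] and [l]; its corners are added to the
    count to avoid a subtraction. The [i]-edge joining the two ends of the path is exempt as well,
    because the path is to be extended by the [j]-edges to [x] and [x ^! i]. *)
Definition ring_path i j l F x s :=
  [/\ pth (x ^! j) (x ^! j ^! i) s,
      forall z, count_mem z s + ((z == x) + (z == x ^! i) + (z == x ^! l) + (z == x ^! l ^! i))
                = subc F x z
    & forall z, subc F x z -> z \notin [:: x; x ^! i; x ^! l; x ^! l ^! i; x ^! j; x ^! j ^! i] ->
        lnk s z (z ^! i)].

Lemma ring_path3 i j l x F : i != j -> i != l -> j != l -> F = [set i; j; l] ->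
  ring_path i j l F x [:: x ^! j; x ^! j ^! l; x ^! j ^! l ^! i; x ^! j ^! i].
Proof.
move=> ij il jl EF.
have lF : l \in F by rewrite EF !inE eqxx !orbT.
have jF : j \in F :\ l by rewrite EF !inE eqxx !orbT jl.
have iF : i \in F :\ l :\ j by rewrite EF !inE eqxx ij il.
have F0 : F :\ l :\ j :\ i = set0.
  by rewrite EF; apply/setP=> t; rewrite !inE; case: (t == i); case: (t == j); case: (t == l).
have S z : (subc F x z : nat) = (z == x) + (z == x ^! i) + (z == x ^! j) + (z == x ^! j ^! i)
   + (z == x ^! l) + (z == x ^! l ^! i) + (z == x ^! j ^! l) + (z == x ^! j ^! l ^! i).
  rewrite (subc_split _ _ lF) !(subc_split _ _ jF) !(subc_split _ _ iF) F0 !subc0.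
  by rewrite (flipC x j l) !addnA.
split.
- rewrite /= !eqxx !andbT adj_flip adj_flip /=.
  by rewrite (_ : x ^! j ^! i = x ^! j ^! l ^! i ^! l) ?adj_flip // (flipC _ l i) flipK.
- by move=> z; rewrite S /= ![_ == z]eq_sym; do 8!move: (nat_of_bool _) => ?; lia.
- move=> z; move: (S z); case: subc => //= e _; rewrite !inE !negb_or.
  move=> /and5P[/negPf e1 /negPf e2 /negPf e3 /negPf e4 /andP[/negPf e5 /negPf e6]].
  move: e; rewrite {}e1 {}e2 {}e3 {}e4 {}e5 {}e6 /lnk !nx_cons2.
  case: eqP => [->|_]; first by rewrite !eqxx !orbT.
  by case: eqP => // ->; rewrite flipK !eqxx !orbT.
Qed.

(** A layer path of the new half is inserted between the first two vertices, whose edge has a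
    direction [t] other than [i] and may be given up. The first step of the result is again known,
    so that the insertion can be repeated. *)
Lemma ring_path_step i j l q t F x r :
  i != q -> i != t -> i \in F -> j \in F -> q \in F -> q != j -> t \in F -> t != q ->
  ring_path i j l (F :\ q) x [:: x ^! j, x ^! j ^! t & r] ->
  exists r', ring_path i j l F x [:: x ^! j, x ^! j ^! q & r'].
Proof.
move=> iq it iF jF qF qj tF tq [ps cs ls].
have iF' : i \in F :\ q by rewrite !inE iq.
have [|||s1 [p1 c1 l1]] := @layer_path n i (F :\ q) (x ^! j ^! q) (x ^! j ^! t ^! q) iF'.
- by rewrite subc_flip2 subc_flip ?subc_refl // !inE tq.
- by rewrite !parity_flip; case: parity.
- by rewrite !flipE (negPf it) addbF.
have E z : subc (F :\ q) (x ^! j ^! q) z = subc (F :\ q) (x ^! q) z.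
  by rewrite (flipC x j q) subc_flipl // !inE eq_sym qj.
have [s1' [e1 _ _]] := elimT (pthP _ _ _) p1.
exists (s1' ++ x ^! j ^! t :: r).
have -> : [:: x ^! j, x ^! j ^! q & s1' ++ x ^! j ^! t :: r] =
          [::] ++ x ^! j :: s1 ++ x ^! j ^! t :: r by rewrite e1.
split.
- exact: pth_splice (ps : pth _ _ ([::] ++ _)) p1 (adj_flip _ _) (adj_flipr _ _).
- by move=> z; rewrite count_splice c1 E (subc_split _ _ qF) -cs addnAC.
- move=> z zF h.
  have: subc (F :\ q) x z || subc (F :\ q) (x ^! q) z.
    by move: (subc_split x z qF); rewrite zF; case: subc; case: subc.
  case/orP=> zs; last by apply/lnk_splice_new/l1; rewrite ?E // /layer.
  apply: (@lnk_splice _ [::]); first exact: ls.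
    by apply: contraNneq h => -[-> _]; rewrite !inE eqxx !orbT.
  apply: contraNneq h => -[h _]; rewrite -(flipK z i) h.
  by rewrite !inE eqxx !orbT.
Qed.

Lemma ring_path_ex i j l F x :
  i != j -> i != l -> j != l -> i \in F -> j \in F -> l \in F ->
  exists t r, [/\ t \in F, t != i & ring_path i j l F x [:: x ^! j, x ^! j ^! t & r]].
Proof.
move: {2}#|F| (leqnn #|F|) => N; elim: N F => [|N IH] F FN ij il jl iF jF lF.
  by move: FN; rewrite leqn0 cards_eq0 => /eqP E; rewrite E inE in iF.
case: (eqVneq F [set i; j; l]) => [E|NE].
  by exists l; eexists; split; [|rewrite eq_sym|apply: ring_path3].
have [q /andP[qF qij]] : exists q : 'I_n, (q \in F) && (q \notin [set i; j; l]).
  apply/existsP; apply: contraR NE; rewrite negb_exists => /forallP H.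
  apply/eqP/setP=> t; move: (H t); rewrite negb_and negbK.
  case: (boolP (t \in F)) => /= [_ ->//|h _]; apply/esym/negbTE.
  by apply: contra h; rewrite !inE -orbA => /or3P[]/eqP->.
move: qij; rewrite !inE !negb_or -andbA => /and3P[qi qj ql].
have FN' : #|F :\ q| <= N by move: FN; rewrite (cardsD1 q) qF.
have [|||t [r [+ ti h]]] := IH (F :\ q) FN' ij il jl.
- by rewrite !inE iF eq_sym qi.
- by rewrite !inE jF eq_sym qj.
- by rewrite !inE lF eq_sym ql.
rewrite !inE => /andP[tq tF].
have [|| r' h'] := ring_path_step _ _ iF jF qF qj tF tq h.
- by rewrite eq_sym.
- by rewrite eq_sym.
by exists q, r'.
Qed.

(** Adding [q] last makes it the direction of the first step; two choices of [q] then give distinct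
    paths. *)
Lemma ring_path_second i j l q F x :
  i != j -> i != l -> j != l -> i \in F -> j \in F -> l \in F ->
  q \in F -> q != i -> q != j -> q != l ->
  exists r, ring_path i j l F x [:: x ^! j, x ^! j ^! q & r].
Proof.
move=> ij il jl iF jF lF qF qi qj ql.
have [|||t [r [+ ti h]]] := @ring_path_ex i j l (F :\ q) x ij il jl.
- by rewrite !inE iF eq_sym qi.
- by rewrite !inE jF eq_sym qj.
- by rewrite !inE lF eq_sym ql.
rewrite !inE => /andP[tq tF].
by apply: ring_path_step _ _ iF jF qF qj tF tq h; rewrite eq_sym.
Qed.

End Ring.

(** * Paths alternating between two matchings *)

Section Determinism.
Variables (n : nat) (m m1 : cube n -> 'I_n -> bool).
Implicit Types (s p : seq (cube n)).
Hypothesis mfun : forall z t t', m z t -> m z t' -> t = t'.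
Hypothesis m1fun : forall z t t', m1 z t -> m1 z t' -> t = t'.

Definition alternates s := forall a b, nx s a b ->
  exists2 t, b = a ^! t & m a t || m1 a t.

Lemma nx_prefix p w q z : uniq (p ++ w :: q) -> nx (p ++ w :: q) z w = nx (rcons p w) z w.
Proof.
rewrite nx_cat cat_uniq => /and3P[_ _ uq]; rewrite orbC; case: (boolP (nx (w :: q) z w)) => //.
by move=> /(nx_index uq)[_ _]; rewrite /= eqxx.
Qed.

(* The vertex following a prefix is forced: it is the [m]-partner of the last vertex
   unless that partner is the previous vertex or does not exist, and then it is the
   [m1]-partner. *)
Lemma alternating_next F u v s s' p w b c q q' :
  HPm m F u v s -> HPm m F u v s' -> alternates s -> alternates s' ->
  s = p ++ [:: w, b & q] -> s' = p ++ [:: w, c & q'] -> b = c.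
Proof.
move=> hs hs' als als' E E'.
have us := HPm_uniq hs; have us' := HPm_uniq hs'.
have nb : nx s w b by apply/nxP; exists p, q.
have nc : nx s' w c by apply/nxP; exists p, q'.
have ws : subc F u w by rewrite -(HPm_mem _ hs) E mem_cat !inE eqxx orbT.
have nxE z : nx s z w = nx s' z w.
  by rewrite E E' !nx_prefix -?E -?E'.
have [ls ls'] : (forall t, m w t -> lnk s w (w ^! t)) /\ (forall t, m w t -> lnk s' w (w ^! t)).
  by case: hs hs' => _ _ h [_ _ h']; split=> t; [apply: h|apply: h'].
have [t eb ht] := als _ _ nb; have [t' ec ht'] := als' _ _ nc.
case: (pickP (m w)) => [t0 m0|no]; last first.
  by move: ht ht'; rewrite !no /= => h h'; rewrite eb ec (m1fun h h').
case: (boolP (nx s (w ^! t0) w)) => h0.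
  have step x y (r : seq (cube n)) : uniq r -> nx r (w ^! t0) w -> nx r w (w ^! x) ->
      m w x || y -> y.
    move=> ur hr hx /orP[mx|//]; move: hx; rewrite (mfun mx m0) => hx.
    by move: (nx_asym ur hr); rewrite hx.
  have h1 := step t (m1 w t) s us h0; have h2 := step t' (m1 w t') s' us'.
  rewrite -nxE -eb -ec in h1 h2.
  by rewrite eb ec (m1fun (h1 nb ht) (h2 h0 nc ht')).
move: (ls _ m0) (ls' _ m0); rewrite /lnk -nxE (negPf h0) !orbF => hb hc.
by rewrite (nx_funr us nb hb) (nx_funr us' nc hc).
Qed.

(** Both lists start at [u] and have the same length, so [alternating_next] extends their common
    prefix to the end. *)
Lemma alternating_unique F u v s s' :
  HPm m F u v s -> HPm m F u v s' -> alternates s -> alternates s' -> s = s'.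
Proof.
move=> hs hs' als als'.
have sz : size s = size s'.
  apply: perm_size; apply/uniq_perm; rewrite ?(HPm_uniq hs) ?(HPm_uniq hs') // => z.
  by rewrite (HPm_mem z hs) (HPm_mem z hs').
have main q : forall q' p w, s = p ++ w :: q -> s' = p ++ w :: q' -> q = q'.
  elim: q => [|b q IH] [|c q'] p w E E' //; try by move: sz; rewrite E E' !size_cat /=; lia.
  have ebc := alternating_next hs hs' als als' E E'; rewrite -{}ebc in E' *.
  by congr cons; apply: (IH _ (rcons p w) b); rewrite cat_rcons.
have [[/pthP[r [e _ _]] _ _] [/pthP[r' [e' _ _]] _ _]] := (hs, hs').
by rewrite e e'; congr cons; apply: (main _ _ [::] u); rewrite ?e ?e'.
Qed.

End Determinism.

(* [lia] splits on every boolean of the goal and of the context. *)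
Local Ltac blia :=
  repeat match goal with |- context [nat_of_bool ?b] => generalize (nat_of_bool b); intro end;
  repeat match goal with H : _ |- _ => clear H end; lia.

Lemma pick_notin (T : finType) (F : {set T}) (s : seq T) : size s < #|F| ->
  exists2 b, b \in F & b \notin s.
Proof.
move=> h; apply/exists_inP; apply: contraTT h; rewrite negb_exists_in -leqNgt => /forall_inP h.
rewrite cardE; apply: uniq_leq_size; first exact: enum_uniq.
by move=> b; rewrite mem_enum => /h; rewrite negbK.
Qed.

Lemma cat_neq (T : eqType) (a b c d : seq T) : b != c -> a ++ b ++ d != a ++ c ++ d.
Proof.
apply: contraNneq => /(congr1 (drop (size a))); rewrite !drop_size_cat // => /(congr1 rev).
by rewrite !rev_cat => /eqP; rewrite eqseq_cat // eqxx /= => /eqP/(can_inj revK)->.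
Qed.

(** * The conditions C1 to C3 in a subcube *)

Section Matching.
Variables (n : nat) (m : cube n -> 'I_n -> bool).
Hypothesis msym : forall z t, m (z ^! t) t = m z t.
Hypothesis mfun : forall z t t', m z t -> m z t' -> t = t'.
Implicit Types (x y z u v w a b c : cube n) (i j k l t : 'I_n) (F : {set 'I_n}).

Definition half F c i p := [forall z, (subc F c z && (cls i z == p)) ==> m z i].

Definition almost F u i :=
  [forall z, [&& subc F u z, cls i z == cls i u, z != u & z != u ^! i] ==> m z i].

(** A half-layer covers exactly the vertices of one class, so equal classes express that it covers
    both ends. *)
Definition c1 F u v := [exists i, (cls i u == cls i v) && half F u i (cls i u)].

Definition c2 F u v := [exists i, exists j,
  [&& i != j, v == u ^! i, almost F u i, m u j & m v j]].

Definition c3 u v := [exists i, (v == u ^! i) && m u i].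

Definition bad F u v := [|| c1 F u v, c2 F u v | c3 u v].

Lemma halfP F c i p :
  reflect (forall z, subc F c z -> cls i z = p -> m z i) (half F c i p).
Proof.
apply: (iffP forallP) => H z; first by move=> h1 h2; move: (H z); rewrite h1 h2 eqxx.
by apply/implyP=> /andP[h1 /eqP h2]; apply: H.
Qed.

Lemma almostP F u i : reflect (forall z, subc F u z -> cls i z = cls i u ->
  z != u -> z != u ^! i -> m z i) (almost F u i).
Proof.
apply: (iffP forallP) => H z; first by move=> h1 h2 h3 h4; move: (H z); rewrite h1 h2 eqxx h3 h4.
by apply/implyP=> /and4P[h1 /eqP h2 h3 h4]; apply: H.
Qed.

Lemma half_eq F a b i p : subc F a b -> half F a i p = half F b i p.
Proof. by move=> h; apply: eq_forallb => z; rewrite (subc_eql h). Qed.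

Lemma c1_sym F u v : subc F u v -> c1 F u v = c1 F v u.
Proof.
move=> h; apply: eq_existsb => i; rewrite eq_sym; case: eqP => //= ->.
exact: half_eq.
Qed.

Lemma almost_flip F u i : i \in F -> almost F (u ^! i) i = almost F u i.
Proof.
move=> iF; apply: eq_forallb => z.
by rewrite subc_flipl // cls_flip_same flipK [(_ != u ^! i) && _]andbC.
Qed.

Lemma c2_sym F u v : subc F u v -> c2 F u v = c2 F v u.
Proof.
suff H a b : subc F a b -> c2 F a b -> c2 F b a.
  by move=> h; apply/idP/idP; apply: H => //; rewrite subc_sym.
move=> h /existsP[i /existsP[j /and5P[ij /eqP e A ma mb]]].
apply/existsP; exists i; apply/existsP; exists j; rewrite {}e in h mb *.
rewrite ij flipK eqxx ma mb almost_flip ?A //.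
by apply: subc_dir h _; rewrite flipE eqxx; case: (a i).
Qed.

Lemma c3_sym u v : c3 u v = c3 v u.
Proof.
suff H a b : c3 a b -> c3 b a by apply/idP/idP; apply: H.
move=> /existsP[i /andP[/eqP-> h]]; apply/existsP; exists i.
by rewrite flipK eqxx msym.
Qed.

Lemma bad_sym F u v : subc F u v -> bad F u v = bad F v u.
Proof. by move=> h; rewrite /bad c1_sym // c2_sym // c3_sym. Qed.

(** A matched edge in another direction would have one end in the class [p], and that end is already
    matched along [i]. *)
Lemma half_only F c i p z t : half F c i p -> (forall z t, m z t -> t \in F) ->
  subc F c z -> m z t -> t = i.
Proof.
move=> /halfP H mF cz mt; case: (eqVneq t i) => // ti.
case: (eqVneq (cls i z) p) => [e|ne]; first by rewrite (mfun mt (H _ cz e)).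
have mt' : m (z ^! t) t by rewrite msym.
apply: mfun mt' _; apply: H; first by rewrite subc_flip // (mF _ _ mt).
by rewrite cls_flip 1?eq_sym //; case: (cls i z) p ne => [] [].
Qed.

(** An edge in another direction has an end in the class of [u]. The only such ends that [almost]
    does not match along [i] are [u] and [u ^! i], and these are matched along [j]. *)
Lemma almost_only F u i j z t : almost F u i -> (forall z t, m z t -> t \in F) ->
  m u j -> m (u ^! i) j -> subc F u z -> m z t -> t != i ->
  t = j /\ z \in [:: u; u ^! i; u ^! j; u ^! i ^! j].
Proof.
move=> /almostP A mF mu mv uz mt ti.
have main w : subc F u w -> m w t -> cls i w = cls i u -> t = j /\ (w = u \/ w = u ^! i).
  move=> uw mw cw; case: (eqVneq w u) mw => [->|wu] mw; first by split; [exact: mfun mw mu|left].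
  case: (eqVneq w (u ^! i)) mw => [->|wv] mw; first by split; [exact: mfun mw mv|right].
  by move: ti; rewrite (mfun mw (A w uw cw wu wv)) eqxx.
case: (eqVneq (cls i z) (cls i u)) => [e|ne].
  by have [-> [->|->]] := main z uz mt e; rewrite !inE eqxx ?orbT.
have [||| -> ] := main (z ^! t); rewrite ?msym //.
- by rewrite subc_flip // (mF _ _ mt).
- by rewrite cls_flip 1?eq_sym //; case: (cls i z) (cls i u) ne => [] [].
- move=> h; split=> //.
  have -> : z = z ^! j ^! j by rewrite flipK.
  by case: h => ->; rewrite !inE eqxx ?orbT.
Qed.

(** For distinct directions, flipping one of them changes only the class for the other. Hence some
    vertex lies in both classes, and it would be matched twice. *)
Lemma half_dir_unique F c i1 i2 p1 p2 :
  i1 \in F -> i2 \in F ->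
  half F c i1 p1 -> half F c i2 p2 -> i1 = i2.
Proof.
move=> h1 h2 /halfP H1 /halfP H2; case: (eqVneq i1 i2) => // n12.
have n21 : i2 != i1 by rewrite eq_sym.
pose w1 := if cls i1 c == p1 then c else c ^! i2.
have e1 : cls i1 w1 = p1.
  by rewrite /w1; case: eqP => // /eqP; rewrite cls_flip //; case: (cls i1 c); case: (p1).
have s1 : subc F c w1 by rewrite /w1; case: ifP; rewrite ?subc_flip // subc_refl.
pose w2 := if cls i2 w1 == p2 then w1 else w1 ^! i1.
have e2 : cls i2 w2 = p2.
  by rewrite /w2; case: eqP => // /eqP; rewrite cls_flip //; case: (cls i2 w1); case: (p2).
have e1' : cls i1 w2 = p1 by rewrite /w2; case: ifP; rewrite ?cls_flip_same.
have s2 : subc F c w2 by rewrite /w2; case: ifP; rewrite ?subc_flip.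
exact: mfun (H1 _ s2 e1') (H2 _ s2 e2).
Qed.

(** * Adding one direction to the subcube *)

Section Step.
Variables (F : {set 'I_n}) (k : 'I_n).
Let F' := F :\ k.
Hypothesis kF : k \in F.
Hypothesis mF : forall z t, m z t -> t \in F'.
Hypothesis F5 : 5 <= #|F'|.

Definition two F u v := exists s s' : seq (cube n), [/\ s != s', HPm m F u v s & HPm m F u v s'].

Hypothesis IH : forall u v, subc F' u v -> parity u != parity v -> ~~ bad F' u v -> two F' u v.

Lemma mk z : m z k = false.
Proof. by apply/negP=> /mF; rewrite !inE eqxx. Qed.

(** As [u] is matched along [i], C1 and C3 could hold only in direction [i], where [u] and [x]
    agree. In C2 the direction [j] would be [i], and the almost half-layer in direction [t] would
    clash with the half-layer in direction [i]. *)
Lemma good_half u x i : half F' u i (cls i u) -> subc F' u x -> parity u != parity x ->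
  x i = u i -> ~~ bad F' u x.
Proof.
move=> hi ux pux xi; have mui : m u i by apply: (halfP _ _ _ _ hi); rewrite ?subc_refl.
apply/negP=> /or3P[/existsP[t /andP[e ht]]|/existsP[t /existsP[j /and5P[tj /eqP e At mj mj']]]
  |/existsP[t /andP[/eqP e mt]]].
- have mut : m u t by apply: (halfP _ _ _ _ ht); rewrite ?subc_refl.
  by move: e; rewrite (mfun mut mui) cls_eq // xi eqxx.
- have ji := mfun mj mui; rewrite ji in tj mj' *.
  (* Flipping two directions besides [i] and [t] preserves the classes of [u] for both and avoids
     [u] and [u ^! t]; the vertex reached would be matched along [i] and along [t]. *)
  have [b bF] := @pick_notin _ F' [:: i; t] (leq_trans (isT : 2 < 5) F5).
  rewrite !inE negb_or => /andP[bi bt].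
  have [c cF] := @pick_notin _ F' [:: i; t; b] (leq_trans (isT : 3 < 5) F5).
  rewrite !inE !negb_or => /and3P[ci ct cb].
  have sw : subc F' u (u ^! b ^! c) by rewrite !subc_flip ?subc_refl.
  have mwt : m (u ^! b ^! c) t.
    apply: (almostP _ _ _ At) => //.
    + by rewrite !cls_flip ?negbK // eq_sym.
    + by apply/eqP => /ffunP/(_ b); rewrite !flipE eqxx eq_sym (negPf cb); case: (u b).
    + by apply/eqP => /ffunP/(_ b); rewrite !flipE eqxx eq_sym (negPf cb) (negPf bt); case: (u b).
  have mwi : m (u ^! b ^! c) i.
    by apply: (halfP _ _ _ _ hi) => //; rewrite !cls_flip ?negbK // eq_sym.
  by rewrite (mfun mwt mwi) eqxx in tj.
- have ti := mfun mt mui; move: xi; rewrite e ti flipE eqxx; by case: (u i).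
Qed.

(** Two differing coordinates put [x] at distance at least two from [u], which excludes C2 and C3;
    C1 is excluded by the assumption on half-layers. *)
Lemma good_far u x f1 f2 : (forall i, ~~ half F' u i (cls i u)) -> f1 != f2 ->
  x f1 != u f1 -> x f2 != u f2 -> ~~ bad F' u x.
Proof.
move=> nh f12 h1 h2.
have far t : x != u ^! t.
  apply/eqP=> e; move: h1 h2; rewrite e !flipE.
  case: (eqVneq f1 t) => [e1|_]; last by rewrite addbF eqxx.
  by rewrite e1 eq_sym in f12; rewrite (negPf f12) addbF eqxx.
apply/negP=> /or3P[/existsP[t /andP[_ ht]]|/existsP[t /existsP[j /and5P[_ e _ _ _]]]
  |/existsP[t /andP[e _]]].
- by rewrite (negPf (nh t)) in ht.
- by rewrite (negPf (far t)) in e.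
- by rewrite (negPf (far t)) in e.
Qed.

(** * Ends on different sides *)

Definition setc (b : bool) x i := if x i == b then x else x ^! i.

Lemma setcE (b : bool) x i : setc b x i i = b.
Proof. by rewrite /setc; case: eqP => // /eqP; rewrite flipE eqxx; case: (x i) b => [] []. Qed.

Lemma setcN (b : bool) x i t : t != i -> setc b x i t = x t.
Proof. by rewrite /setc; case: ifP => //; rewrite flipE => _ /negPf->; rewrite addbF. Qed.

Lemma subc_setc (G : {set 'I_n}) c (b : bool) x i : i \in G -> subc G c (setc b x i) = subc G c x.
Proof. by rewrite /setc; case: ifP => // _; apply: subc_flip. Qed.

(** The coordinate [f5] is reserved for correcting the parity. *)
Lemma cube_pick u f1 f2 f3 f4 f5 (b1 b2 b3 b4 : bool) :
  uniq [:: f1; f2; f3; f4; f5] -> {subset [:: f1; f2; f3; f4; f5] <= F'} ->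
  exists x, [/\ subc F' u x, parity u != parity x, x f1 = b1, x f2 = b2 & x f3 = b3 /\ x f4 = b4].
Proof.
rewrite /= !inE !negb_or => /and5P[/and4P[n12 n13 n14 n15] /and3P[n23 n24 n25]
  /andP[n34 n35] n45 _] sF.
have [g1 g2 g3 g4 g5] : [/\ f1 \in F', f2 \in F', f3 \in F', f4 \in F' & f5 \in F'].
  by split; apply: sF; rewrite !inE eqxx ?orbT.
pose y := setc b1 (setc b2 (setc b3 (setc b4 u f4) f3) f2) f1.
have y1 : y f1 = b1 by rewrite setcE.
have y2 : y f2 = b2 by rewrite /y setcN 1?eq_sym // setcE.
have y3 : y f3 = b3 by rewrite /y setcN 1?eq_sym // setcN 1?eq_sym // setcE.
have y4 : y f4 = b4 by rewrite /y setcN 1?eq_sym // setcN 1?eq_sym // setcN 1?eq_sym // setcE.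
have sy : subc F' u y by rewrite !subc_setc // subc_refl.
case: (eqVneq (parity u) (parity y)) => e; last by exists y.
exists (y ^! f5); split; rewrite ?flipE ?subc_flip ?parity_flip //.
- by rewrite e; case: parity.
- by rewrite (negPf n15) addbF.
- by rewrite (negPf n25) addbF.
- by rewrite (negPf n35) (negPf n45) !addbF.
Qed.

Lemma pick5 i j : i \in F' -> j \in F' -> i != j ->
  exists f3 f4 f5, uniq [:: i; j; f3; f4; f5] /\ {subset [:: i; j; f3; f4; f5] <= F'}.
Proof.
move=> iF jF ij.
have [f3 F3 n3] := @pick_notin _ F' [:: i; j] (leq_trans (isT : 2 < 5) F5).
have [f4 F4 n4] := @pick_notin _ F' [:: i; j; f3] (leq_trans (isT : 3 < 5) F5).
have [f5 F5' n5] := @pick_notin _ F' [:: i; j; f3; f4] F5.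
exists f3, f4, f5; split.
  move: n3 n4 n5; rewrite /= !inE !negb_or ij.
  by rewrite ![f3 == _]eq_sym ![f4 == _]eq_sym ![f5 == _]eq_sym
    => /andP[-> ->] /and3P[-> -> ->] /and4P[-> -> -> ->].
by apply/allP; rewrite /= iF jF F3 F4 F5'.
Qed.

(** An end covered by a half-layer of its side in direction [i] asks the link to agree with it at
    [i]; an end without one asks for two coordinates of difference. Four prescribed coordinates
    therefore suffice. *)
Lemma pick_link u v : v k != u k -> subc F u v -> parity u != parity v -> ~~ c1 F u v ->
  exists x, [/\ subc F' u x, parity u != parity x, ~~ bad F' u x & ~~ bad F' v (x ^! k)].
Proof.
move=> vk suv puv n1.
have suv' : subc F' (u ^! k) v.
  by apply: subc_D1I; rewrite ?subc_flipl // flipE eqxx; case: (u k) (v k) vk => [] [].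
have fin x : subc F' u x -> parity u != parity x ->
    subc F' v (x ^! k) /\ parity v != parity (x ^! k).
  move=> sx px; split; first by rewrite -(subc_eql suv') subc_flip2.
  by rewrite parity_flip; case: (parity u) (parity v) (parity x) puv px => [] [] [].
have xk x t : t \in F' -> (x ^! k) t = x t.
  by rewrite !inE flipE => /andP[/negPf-> _]; rewrite addbF.
have hm c t : half F' c t (cls t c) -> t \in F'.
  by move=> /halfP/(_ c (subc_refl _ _) erefl)/mF.
have bl (b1 b2 : bool) : b1 = ~~ b2 -> b1 != b2 by case: b1 b2 => [] [].
have another i : exists2 j, j \in F' & i != j.
  have [j jF] := @pick_notin _ F' [:: i] (leq_trans (isT : 1 < 5) F5).
  by rewrite inE eq_sym; exists j.
have [i0 i0F _] := @pick_notin _ F' [::] (leq_trans (isT : 0 < 5) F5).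
case: (pickP (fun i => half F' u i (cls i u))) => [i hi|nu];
case: (pickP (fun i => half F' v i (cls i v))) => [j hj|nv].
- have [iF jF] := (hm _ _ hi, hm _ _ hj).
  suff [x [sx px xi xj]] : exists x, [/\ subc F' u x, parity u != parity x, x i = u i & x j = v j].
    have [sx' px'] := fin x sx px.
    exists x; split=> //; first exact: good_half hi sx px xi.
    by apply: good_half hj sx' px' _; rewrite xk.
  case: (eqVneq i j) => [e|ij]; last first.
    have [f3 [f4 [f5 [uf sf]]]] := pick5 iF jF ij.
    have [x [? ? ? ? _]] := cube_pick u (u i) (v j) true true uf sf.
    by exists x.
  (* Both ends now constrain the same coordinate. If [u] and [v] differ there, the half-layers of
     the two sides combine to one that covers both ends, contrary to [n1]. *)
  subst j; have [j jF' ij] := another i.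
  have [f3 [f4 [f5 [uf sf]]]] := pick5 iF jF' ij.
  have [x [? ? xi ? _]] := cube_pick u (u i) true true true uf sf.
  exists x; split=> //; rewrite xi; apply/eqP; move: n1; rewrite negb_exists => /forallP/(_ i).
  rewrite cls_eq //; case: eqP => //= /eqP uv.
  case/halfP=> z sz cz.
  have: subc F' u z || subc F' (u ^! k) z.
    by move: (subc_split u z kF); rewrite sz; case: subc; case: subc.
  case/orP=> hz; first exact: (halfP _ _ _ _ hi).
  apply: (halfP _ _ _ _ hj); first by rewrite -(subc_eql suv').
  by rewrite cz; apply/eqP; rewrite cls_eq.
- have iF := hm _ _ hi; have [j jF ij] := another i.
  have [f3 [f4 [f5 [uf sf]]]] := pick5 iF jF ij.
  have [x [sx px xi xj [x3 _]]] := cube_pick u (u i) (~~ v j) (~~ v f3) true uf sf.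
  have [sx' px'] := fin x sx px.
  exists x; split=> //; first exact: good_half hi _ _ _.
  have f3F : f3 \in F' by apply: sf; rewrite !inE eqxx !orbT.
  apply: (@good_far _ _ j f3); [by move=> t; rewrite nv| |by rewrite xk //; apply: bl..].
  by move: uf; rewrite /= !inE !negb_or => /and5P[_ /andP[]].
- have jF := hm _ _ hj; have [i iF ji] := another j.
  have [f3 [f4 [f5 [uf sf]]]] := pick5 jF iF ji.
  have [x [sx px xj xi [x3 _]]] := cube_pick u (v j) (~~ u i) (~~ u f3) true uf sf.
  have [sx' px'] := fin x sx px.
  exists x; split=> //; last by apply: good_half hj _ _ _; rewrite ?xk.
  apply: (@good_far _ _ i f3); [by move=> t; rewrite nu| |by apply: bl..].
  by move: uf; rewrite /= !inE !negb_or => /and5P[_ /andP[]].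
- have [i1 i1F i01] := another i0.
  have [f3 [f4 [f5 [uf sf]]]] := pick5 i0F i1F i01.
  have [x [sx px x1 x2 [x3 x4]]] := cube_pick u (~~ u i0) (~~ u i1) (~~ v f3) (~~ v f4) uf sf.
  have [sx' px'] := fin x sx px.
  have f3F : f3 \in F' by apply: sf; rewrite !inE eqxx !orbT.
  have f4F : f4 \in F' by apply: sf; rewrite !inE eqxx !orbT.
  exists x; split=> //.
    by apply: (@good_far _ _ i0 i1) => //; [move=> t; rewrite nu|apply: bl..].
  apply: (@good_far _ _ f3 f4); [by move=> t; rewrite nv| |by rewrite xk //; apply: bl..].
  by move: uf; rewrite /= !inE !negb_or => /and5P[_ _ /andP[]].
Qed.

Lemma two_opposite u v : v k != u k -> subc F u v -> parity u != parity v -> ~~ bad F u v ->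
  two F u v.
Proof.
move=> vk suv puv; rewrite /bad negb_or => /andP[n1 _].
have [x [sx px bx bv]] := pick_link vk suv puv n1.
have suv' : subc F' (u ^! k) v.
  by apply: subc_D1I; rewrite ?subc_flipl // flipE eqxx; case: (u k) (v k) vk => [] [].
have [s1 [s2 [ns h1 h2]]] := IH sx px bx.
have sxv : subc F' (x ^! k) v by rewrite -(subc_eql (a := u ^! k)) // subc_flip2.
have [||q [_ [_ hq _]]] := IH sxv.
- by rewrite parity_flip; case: (parity u) (parity v) (parity x) puv px => [] [] [].
- by rewrite bad_sym.
exists (s1 ++ q), (s2 ++ q); split.
- exact: (@cat_neq _ [::]).
- exact: HPm_cat kF mk h1 hq.
- exact: HPm_cat kF mk h2 hq.
Qed.

(** * Ends on one side, with C1 or C2 there *)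

Lemma neq_k t : t \in F' -> t == k = false.
Proof. by rewrite !inE => /andP[/negPf]. Qed.

(** By [half_dir_unique] at most one such direction exists; if there is none, [j] is an arbitrary
    direction other than [i]. *)
Lemma other_half_dir c i : i \in F' -> exists j, [/\ j \in F', j != i
  & forall t p, t != i -> t \in F' -> half F' c t p -> t = j].
Proof.
move=> iF; pose h t := [&& t \in F', t != i & [exists p, half F' c t p]].
case: (pickP h) => [j /and3P[jF ji /existsP[p hj]]|no].
  by exists j; split=> // t p' ti tF ht; apply: half_dir_unique ht hj.
have [j jF] := @pick_notin _ F' [:: i] (leq_trans (isT : 1 < 5) F5).
rewrite inE => ji; exists j; split=> // t p ti tF ht.
by have := no t; rewrite /h tF ti /= => /existsP[]; exists p.
Qed.

(** C1 fails in direction [i] because of [z], in direction [j] because the ends agree there, and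
    elsewhere because there is no half-layer. C2 and C3 fail because the ends differ at both [i] and
    [l]. *)
Lemma two_far c i j x y z l :
  (forall t p, t != i -> t \in F' -> half F' c t p -> t = j) ->
  subc F' c x -> subc F' c y -> parity x != parity y ->
  x i != y i -> l != i -> x l != y l -> x j = y j ->
  subc F' c z -> cls i z = cls i x -> ~~ m z i -> two F' x y.
Proof.
move=> hj sx sy pxy xyi li xyl xyj sz cz nz; apply: IH => //.
  by rewrite -(subc_eql sx).
have far t : y != x ^! t.
  apply/eqP=> e; move: xyi xyl; rewrite e !flipE.
  case: (eqVneq i t) => [<-|_]; last by rewrite addbF eqxx.
  by rewrite (negPf li) addbF eqxx.
apply/negP=> /or3P[/existsP[t /andP[e ht]]|/existsP[t /existsP[? /and5P[_ e _ _ _]]]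
  |/existsP[t /andP[e _]]].
- move: e; rewrite cls_eq // => xyt.
  rewrite -(half_eq _ _ sx) in ht.
  case: (eqVneq t i) ht => [->|ti] ht.
    by case/negP: nz; apply: (halfP _ _ _ _ ht).
  have tF : t \in F'.
    by have := halfP _ _ _ _ ht x sx erefl => /mF.
  by move: xyt; rewrite (hj _ _ ti tF ht) xyj eqxx.
- by rewrite (negPf (far t)) in e.
- by rewrite (negPf (far t)) in e.
Qed.

Lemma split_side u z : subc F u z -> subc F' u z || subc F' (u ^! k) z.
Proof. by move=> h; move: (subc_split u z kF); rewrite h; case: subc; case: subc. Qed.

(* Side [0] is covered by two paths [u .. x] and [y .. v], and side [1] by a path
   [x^k .. y^k]. *)
Lemma two_join u v x y s q : subc F' u x ->
  pth u x s -> pth y v q -> (forall z, count_mem z s + count_mem z q = subc F' u z) ->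
  (forall z t, subc F' u z -> m z t -> lnk s z (z ^! t) || lnk q z (z ^! t)) ->
  two F' (x ^! k) (y ^! k) -> two F u v.
Proof.
move=> sx ps pq csq lsq [r1 [r2 [nr h1 h2]]].
suff H r : HPm m F' (x ^! k) (y ^! k) r -> HPm m F u v (s ++ r ++ q).
  by exists (s ++ r1 ++ q), (s ++ r2 ++ q); split; [exact: cat_neq|exact: H..].
have E z : subc F' (x ^! k) z = subc F' (u ^! k) z.
  by apply/esym/subc_eql; rewrite subc_flip2.
case=> pr cr lr; split.
- apply: pth_cat ps _ (adj_flip _ k); apply: pth_cat pr pq (adj_flipr _ _).
- by move=> z; rewrite !count_cat addnCA cr E csq addnC -subc_split.
- move=> z t /split_side/orP[sz|sz] mt.
    by case/orP: (lsq _ _ sz mt) => h; [apply: lnk_catl|apply/lnk_catr/lnk_catr].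
  by apply: lnk_mono; apply: lr; rewrite ?E.
Qed.

(** By [half_only] this side is matched along [i] only, so a cut along [l] leaves two layer paths,
    from [u] to [u ^! b] and from [y] to [v]. *)
Lemma two_same_c1 u v : subc F' u v -> parity u != parity v -> ~~ bad F u v ->
  c1 F' u v -> two F u v.
Proof.
move=> sv puv nb /existsP[i /andP[e hi]].
move: nb; rewrite /bad !negb_or => /and3P[n1 _ n3].
have mui : m u i by apply: (halfP _ _ _ _ hi); rewrite ?subc_refl.
have iF : i \in F' by exact: mF mui.
have uvi : u i != v i by rewrite -cls_eq.
have [z [sz cz nz]] : exists z, [/\ subc F' (u ^! k) z, cls i z = cls i u & ~~ m z i].
  move: n1; rewrite negb_exists => /forallP/(_ i); rewrite e /= negb_forall => /existsP[z].
  rewrite negb_imply => /andP[/andP[/split_side/orP[] sz /eqP cz] nz]; last by exists z.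
  by case/negP: nz; apply: (halfP _ _ _ _ hi).
have [j [jF ji hj]] := @other_half_dir (u ^! k) i iF.
(* By parity the ends differ in an odd number of coordinates, one of them [i]. As [uv] is unmatched
   there are at least three, so one is neither [i] nor [j]. *)
have [l [lF li lj ul]] : exists l, [/\ l \in F', l != i, l != j & u l != v l].
  have vi : (u ^! i) i = v i by rewrite flipE eqxx; case: (u i) (v i) uvi => [] [].
  have /neq_coord[l1 h1] : u ^! i != v.
    apply: contraNneq n3 => e'; apply/existsP; exists i; by rewrite -e' eqxx mui.
  have /neq_coord[l2 h2] : u ^! i ^! l1 != v.
    by apply: contraNneq puv => <-; rewrite !parity_flip negbK.
  have l21 : l2 != l1.
    apply: contraNneq h2 => ->; rewrite [_ l1]flipE eqxx.
    by case: ((u ^! i) l1) (v l1) h1 => [] [].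
  rewrite [_ l2]flipE (negPf l21) addbF in h2.
  have N t : (u ^! i) t != v t -> [/\ t \in F', t != i & u t != v t].
    move=> ht; have ti : t != i by apply: contraNneq ht => ->; rewrite vi.
    move: ht; rewrite flipE (negPf ti) addbF => ht; split=> //.
    by apply: subc_dir sv _; rewrite eq_sym.
  have [F1 i1 u1] := N _ h1; have [F2 i2 u2] := N _ h2.
  by case: (eqVneq l1 j) l21 => [-> l21|l1j _]; [exists l2|exists l1].
have iF2 : i \in F' :\ l by rewrite !inE eq_sym li; move: iF; rewrite !inE.
have jF2 : j \in F' :\ l by rewrite !inE eq_sym lj; move: jF; rewrite !inE.
have [b bF] := @pick_notin _ F' [:: i; j; l] (leq_trans (isT : 3 < 5) F5).
rewrite !inE !negb_or => /and3P[bi bj bl].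
have bF2 : b \in F' :\ l by rewrite !inE bl; move: bF; rewrite !inE.
(* A neighbour of [v] that agrees with [u ^! b] at [j], so that C1 cannot hold in direction [j] on
   the other side. *)
pose y := if v j == u j then v ^! b else v ^! j.
have yj : y j = u j.
  rewrite /y; case: eqP => [<-|]; first by rewrite flipE eq_sym (negPf bj) addbF.
  by rewrite flipE eqxx; case: (v j); case: (u j).
have yE t : t != b -> t != j -> y t = v t.
  by rewrite /y => /negPf tb /negPf tj; case: ifP => _; rewrite flipE ?tb ?tj addbF.
have yl : y l = v l by apply: yE; rewrite // eq_sym.
have yi : y i = v i by apply: yE; rewrite eq_sym.
have py : parity y = ~~ parity v by rewrite /y; case: ifP; rewrite parity_flip.
have syl : subc (F' :\ l) v y by rewrite /y; case: ifP => _; rewrite subc_flip ?subc_refl.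
have [|||s [ps cs ls]] := @layer_path _ i (F' :\ l) u (u ^! b) iF2.
- by rewrite subc_flip ?subc_refl.
- by rewrite parity_flip; case: parity.
- by rewrite flipE eq_sym (negPf bi) addbF.
have [|||q [pq cq lq]] := @layer_path _ i (F' :\ l) y v iF2.
- by rewrite subc_sym.
- by rewrite py; case: parity.
- by rewrite yi.
have svl : subc (F' :\ l) (u ^! l) v.
  by apply: subc_D1I; rewrite ?subc_flipl // flipE eqxx; case: (u l) (v l) ul => [] [].
have E w : subc (F' :\ l) y w = subc (F' :\ l) (u ^! l) w.
  by rewrite (subc_eql svl) (subc_eql syl).
apply: (two_join (x := u ^! b) (y := y)) ps pq _ _ _.
- by rewrite subc_flip ?subc_refl.
- by move=> w; rewrite cs cq E -subc_split.
- move=> w t sw mt; have ti := half_only hi mF sw mt.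
  have: subc (F' :\ l) u w || subc (F' :\ l) (u ^! l) w.
    by move: (subc_split u w lF); rewrite sw; case: subc; case: subc.
  rewrite ti => /orP[] h; first by rewrite ls // /layer.
  by rewrite lq ?orbT ?E // /layer.
- apply: (two_far hj _ _ _ _ li _ _ sz _ nz).
  + by rewrite subc_flip2 subc_flip ?subc_refl.
  + by rewrite subc_flip2; apply: subc_trans sv _; apply: subc_D1_sub syl.
  + by rewrite !parity_flip py !negbK.
  + by rewrite !flipE (neq_k iF) !addbF [i == b]eq_sym (negPf bi) addbF yi.
  + by rewrite !flipE (neq_k lF) !addbF [l == b]eq_sym (negPf bl) addbF yl.
  + by rewrite !flipE (neq_k jF) !addbF [j == b]eq_sym (negPf bj) addbF yj.
  + rewrite cz !cls_flip ?negbK // 1?eq_sym // .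
    by rewrite eq_sym neq_k.
Qed.

Lemma two_same_c2 u v : subc F' u v -> parity u != parity v -> ~~ bad F u v ->
  c2 F' u v -> two F u v.
Proof.
move=> sv puv nb /existsP[i /existsP[j /and5P[ij /eqP e At mu mv]]].
move: nb; rewrite /bad !negb_or => /and3P[_ n2 _].
rewrite {}e in sv puv n2 mv *.
have iF : i \in F' by apply: subc_dir sv _; rewrite flipE eqxx; case: (u i).
have jF : j \in F' by exact: mF mu.
(* Otherwise the other side completes the almost half-layer, and C2 holds in [F]. *)
have [z [sz cz nz]] : exists z, [/\ subc F' (u ^! k) z, cls i z = cls i u & ~~ m z i].
  move: n2; rewrite negb_exists => /forallP/(_ i); rewrite negb_exists => /forallP/(_ j).
  rewrite ij eqxx mu mv /= andbT negb_forall => /existsP[z].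
  rewrite negb_imply => /andP[/and4P[/split_side/orP[] sz /eqP cz zu zv] nz]; last by exists z.
  by case/negP: nz; apply: (almostP _ _ _ At).
have [j' [j'F j'i hj]] := @other_half_dir (u ^! k) i iF.
have [b bF] := @pick_notin _ F' [:: i; j; j'] (leq_trans (isT : 3 < 5) F5).
rewrite !inE !negb_or => /and3P[bi bj bj'].
have [c cF] := @pick_notin _ F' [:: i; j; j'; b] F5.
rewrite !inE !negb_or => /and4P[ci cj cj' cb].
have [ib jb j'b bc] : [/\ i != b, j != b, j' != b & b != c] by split; rewrite eq_sym.
have [ic jc j'c] : [/\ i != c, j != c & j' != c] by split; rewrite eq_sym.
have ij' : i != j' by rewrite eq_sym.
pose y := u ^! j ^! b ^! c.
have sy : subc F' u y by rewrite !subc_flip // subc_refl.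
have py : parity u != parity y by rewrite !parity_flip; case: parity.
have yi : u i = y i by rewrite !flipE (negPf ij) (negPf ib) (negPf ic) !addbF.
have yb : u b != y b by rewrite !flipE eqxx (negPf bj) (negPf bc) !addbF; case: (u b).
have [r [pr cr lr]] := layer_path2 iF jF bF ij bi bj sy py yi yb.
have suij : subc F' u (u ^! i ^! j) by rewrite !subc_flip // subc_refl.
(* The layer path first runs around a square. Stepping from [u] straight to [u ^! j] instead gives
   the path to [y], and the remaining two corners form the path that ends in [u ^! i]. *)
apply: (@two_join u (u ^! i) y (u ^! i ^! j) [:: u, u ^! j & r] [:: u ^! i ^! j; u ^! i]) => //.
- have /pth_split[_ h _] : pth u y ([:: u; u ^! i] ++ [:: u ^! i ^! j, u ^! j & r]) by [].
  by apply: pth_cons h; rewrite adj_flip.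
- by rewrite /= !eqxx adj_flipr.
- by move=> w; rewrite -cr /=; blia.
- move=> w t sw mt; case: (eqVneq t i) => [e|ti]; last first.
    have [-> ] := almost_only At mF mu mv sw mt ti.
    rewrite !inE => /or4P[] /eqP->; rewrite /lnk !nx_cons2 ?flipK !eqxx ?orbT //.
  rewrite {}e in mt *.
  (* All four corners of the square are matched along [j], so an edge matched along [i] avoids
     them. *)
  have nw : w \notin [:: u; u ^! i; u ^! i ^! j; u ^! j].
    have mj x : m x j -> w = x -> False.
      by move=> mx e; move: ij; rewrite -(mfun mt (t' := j)) ?eqxx // e.
    rewrite !inE !negb_or; apply/and4P; split; apply/eqP; apply: mj => //; by rewrite msym.
  have := lr w i sw (eqxx _).
  have nxe a b' s' : nx (a :: b' :: s') w (w ^! i) -> w != a -> nx (b' :: s') w (w ^! i).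
    by rewrite nx_cons2 => /orP[/andP[/eqP-> _]|//]; rewrite eqxx.
  have nxe' a b' s' : nx (a :: b' :: s') (w ^! i) w -> w != b' -> nx (b' :: s') (w ^! i) w.
    by rewrite nx_cons2 => /orP[/andP[_ /eqP->]|//]; rewrite eqxx.
  move: nw; rewrite !inE !negb_or => /and4P[w1 w2 w3 w4].
  case/orP=> h; apply/orP; left; rewrite /lnk !nx_cons2.
    by have := nxe _ _ _ (nxe _ _ _ (nxe _ _ _ h w1) w2) w3 => ->; rewrite !orbT.
  by have := nxe' _ _ _ (nxe' _ _ _ (nxe' _ _ _ h w2) w3) w4 => ->; rewrite !orbT.
- apply: (two_far hj _ _ _ _ bi _ _ sz _ nz); rewrite ?subc_flip2 //.
  + by rewrite !parity_flip; case: parity.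
  + by rewrite !flipE (neq_k iF) (negPf ij) (negPf ib) (negPf ic) eqxx !addbF; case: (u i).
  + by rewrite !flipE (neq_k bF) (negPf bj) (negPf bi) (negPf bc) eqxx !addbF; case: (u b).
  + by rewrite !flipE (neq_k j'F) (negPf j'i) (negPf j'b) (negPf j'c) !addbF.
  + rewrite cz !cls_flip ?negbK //.
    by rewrite neq_k.
Qed.

(** * Ends on one side, with detours through the other side *)

Definition unmatched a b := [forall t, (b == a ^! t) ==> ~~ m a t].

Lemma unmatchedP a b t : unmatched a b -> b = a ^! t -> m a t = false.
Proof. by move=> /forallP/(_ t) h e; apply/negbTE; move: h; rewrite e eqxx. Qed.

Lemma unmatched_flip a t : unmatched a (a ^! t) = ~~ m a t.
Proof.
apply/idP/idP => [/unmatchedP/(_ erefl)->//|h].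
by apply/forallP=> t'; apply/implyP=> /eqP/flip_dir <-.
Qed.

Lemma insert_pair u v P z w : pth u v P -> lnk P z w ->
  exists P', [/\ pth u v P', lnk P' (z ^! k) (w ^! k),
    forall c, count_mem c P' = count_mem c P + ((c == z ^! k) + (c == w ^! k))
  & forall a b, nx P a b -> (a, b) != (z, w) -> (a, b) != (w, z) -> nx P' a b].
Proof.
wlog h : z w / nx P z w.
  move=> H p /orP[h|h]; first by apply: H => //; rewrite /lnk h.
  have [|P' [h1 h2 h3 h4]] := H w z h p; first by rewrite /lnk h.
  exists P'; split=> // [|c|a b ? ? ?]; first by rewrite lnkC.
    by rewrite h3 [_ + (c == z ^! k)]addnC.
  exact: h4.
move=> p _; have [s1 [s2 E]] := elimT (nxP _ _ _) h; rewrite {}E in p h *.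
have azw := nx_adj p h.
exists (s1 ++ z :: [:: z ^! k; w ^! k] ++ w :: s2); split.
- apply: pth_splice p _ (adj_flip _ k) (adj_flipr _ k).
  case/adjP: azw => i ->; rewrite /= !eqxx !andbT.
  by apply/adjP; exists i; rewrite flipC.
- by apply: lnk_splice_new; rewrite /lnk !nx_cons2 !eqxx.
- by move=> c; rewrite count_splice /= addn0 ![_ == c]eq_sym.
- by move=> a b h' n1 _; apply: nx_splice.
Qed.

(** C2 leaves only two matched edges outside direction [i] on the side of [X = x ^! k]. For a
    suitable [l], the path [P] also contains the edge from [z = x ^! l] in direction [i]; a detour
    there picks up [Z = X ^! l] and [Z ^! i], and a ring path inserted at [x] covers the rest of the
    other side. *)
Lemma two_shadow_c2 u v P x y :
  HPm m F' u v P -> nx P x y -> unmatched x y -> c2 F' (x ^! k) (y ^! k) ->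
  (forall a b, nx P a b -> unmatched a b -> bad F' (a ^! k) (b ^! k)) -> two F u v.
Proof.
move=> hP nxy uxy /existsP[i /existsP[j /and5P[ij /eqP e At mu mv]]] allbad.
have {e} ey : y = x ^! i by apply: (@flip_inj _ k); rewrite e flipC.
subst y; set X := x ^! k in At mu mv.
have eX : x ^! i ^! k = X ^! i by rewrite flipC.
rewrite {}eX in mv.
have [pP cP lP] := hP; have uP := HPm_uniq hP.
have memP z : (z \in P) = subc F' u z by apply: HPm_mem hP.
have [xs ys _] := nx_index uP nxy; rewrite !memP in xs ys.
have iF : i \in F'.
  apply: (subc_dir (c := x) (z := x ^! i)); last by rewrite flipE eqxx; case: (x i).
  by rewrite -(subc_eql xs).
have jF : j \in F' by exact: mF mu.
have SX c : subc F' X c = subc F' (u ^! k) c.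
  by apply/esym/subc_eql; rewrite subc_flip2.
have flipk a t : a ^! t ^! k = a ^! k ^! t by rewrite flipC.
(* By parity [w] is adjacent to at most one of [x] and [x ^! i], hence along at most one direction.
   Avoiding these directions for [u] and [v] keeps [z] away from the ends of [P]. *)
have lbl w : exists lw, forall l, (x ^! l = w \/ x ^! i ^! l = w) -> l = lw.
  case: (pickP (fun l => (x ^! l == w) || (x ^! i ^! l == w))) => [lw hw|no]; last first.
    by exists i => l [] /eqP h; move: (no l); rewrite h ?orbT.
  exists lw => l hl.
  have pN a b t t' : a ^! t = b ^! t' -> parity a = parity b.
    by move/(congr1 (@parity n)); rewrite !parity_flip => /negb_inj.
  have xN : parity x = parity (x ^! i) -> False by rewrite parity_flip; case: parity.
  case/orP: hw => /eqP hw; case: hl => hl.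
  - by apply: (@flip_dir _ x); rewrite hl hw.
  - by case: xN; apply: (pN _ _ lw l); rewrite hw hl.
  - by case: xN; apply: (pN _ _ l lw); rewrite hw hl.
  - by apply: (@flip_dir _ (x ^! i)); rewrite hl hw.
have [lu hlu] := lbl u; have [lv hlv] := lbl v.
have [l lF] := @pick_notin _ F' [:: i; j; lu; lv] F5.
rewrite !inE !negb_or => /and4P[li lj llu llv].
have [il jl] : i != l /\ j != l by split; rewrite eq_sym.
pose z := x ^! l; pose Z := X ^! l.
have eZ : z ^! k = Z by rewrite /z flipk.
have zP : z \in P by rewrite memP subc_flip.
have ZX : subc F' X Z by rewrite subc_flip ?subc_refl.
have Zn4 : Z \notin [:: X; X ^! i; X ^! j; X ^! i ^! j].
  rewrite !inE !negb_or; apply/and4P; split; apply/eqP => /ffunP/(_ l);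
  by rewrite !flipE eqxx ?(negPf li) ?(negPf lj); case: (x l); case: (l == k).
have onlyZ t : m Z t -> t = i.
  move=> mt; apply/eqP; apply: contraNT Zn4 => ti.
  by have [] := almost_only At mF mu mv ZX mt ti.
(* [Z] can be matched only along [i], so C1 and C3 force [t = i]; C2 would yield a vertex [W]
   matched along both [t] and [i]. *)
have claim t : bad F' Z (Z ^! t) -> t \in F' -> t = i.
  move=> bZ tF; case: (eqVneq t i) => // ti.
  have dirE t' : Z ^! t == Z ^! t' -> t' = t by move=> /eqP/flip_dir.
  case/or3P: bZ => [/existsP[t' /andP[+ h]]|/existsP[t' /existsP[j' /and5P[_ /dirE e A' _ _]]]
    |/existsP[t' /andP[/dirE-> /onlyZ//]]].
    have mt' : m Z t' by apply: (halfP _ _ _ _ h); rewrite ?subc_refl.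
    rewrite cls_eq ?parity_flip; last by case: parity.
    rewrite [in X in _ != X]flipE; case: (eqVneq t' t) => [<- _|_]; first exact: onlyZ.
    by rewrite addbF eqxx.
  rewrite {}e in A'.
  have [b bF] := @pick_notin _ F' [:: i; t; l] (leq_trans (isT : 3 < 5) F5).
  rewrite !inE !negb_or => /and3P[bi bt bl].
  pose W := Z ^! i ^! b.
  have SW : subc F' X W by rewrite /W subc_flip // subc_flip.
  have Wb : W b = ~~ X b by rewrite !flipE eqxx (negPf bi) (negPf bl) !addbF addbT.
  have nW c : c b = X b -> W != c.
    by move=> h; apply/eqP=> /ffunP/(_ b); rewrite Wb h; case: (X b).
  have mWi : m W i.
    apply: (almostP _ _ _ At) => //; [|exact: nW|by apply: nW; rewrite flipE (negPf bi) addbF].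
    by rewrite cls_flip 1?eq_sym // cls_flip_same cls_flip ?negbK.
  have mWt : m W t.
    apply: (almostP _ _ _ A').
    - by rewrite -(subc_eql ZX).
    - by rewrite /W cls_flip 1?eq_sym // cls_flip ?negbK.
    - by apply: nW; rewrite flipE (negPf bl) addbF.
    - by apply: nW; rewrite !flipE (negPf bl) (negPf bt) !addbF.
  exact: mfun mWt mWi.
have nzu : z != u by apply: contraNneq llu => h; rewrite (hlu l) //; left.
have nzv : z != v by apply: contraNneq llv => h; rewrite (hlv l) //; left.
(* Being inner, [z] has two edges on [P], and one of them is unmatched. The opposite edge is bad by
   [allbad], so its direction is [i] by [claim]. *)
have [zl mz] : lnk P z (z ^! i) /\ ~~ m z i.
  have nbr t : lnk P z (z ^! t) -> ~~ m z t -> t = i.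
    move=> L nm.
    have tF : t \in F'.
      have : subc F' z (z ^! t).
        rewrite -(subc_eql (a := u)); first by case/orP: L => /(nx_index uP)[]; rewrite !memP.
        by rewrite -memP.
      by move=> h; apply: subc_dir h _; rewrite flipE eqxx; case: (z t).
    apply: claim => //; case/orP: L => h.
      by move: (allbad _ _ h); rewrite unmatched_flip => /(_ nm); rewrite flipk eZ.
    have := allbad _ _ h; rewrite -{2}(flipK z t) unmatched_flip msym => /(_ nm).
    rewrite flipk eZ bad_sym // subc_sym subc_flip ?subc_refl //.
  have [a [b [na nb]]] := pth_interior pP zP nzu nzv.
  have [ta ea] := elimT (adjP _ _) (nx_adj pP na).
  have [tb eb] := elimT (adjP _ _) (nx_adj pP nb).
  have {}ea : a = z ^! ta by rewrite ea flipK.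
  have La : lnk P z (z ^! ta) by rewrite -ea /lnk na orbT.
  have Lb : lnk P z (z ^! tb) by rewrite -eb /lnk nb.
  case: (boolP (m z ta)) => ma; last by rewrite -(nbr _ La ma).
  case: (boolP (m z tb)) => mb; last by rewrite -(nbr _ Lb mb).
  by move: (nx_asym uP na); rewrite ea (mfun ma mb) -eb nb.
have [P' [pP' lZ cP' nP']] := insert_pair pP zl.
rewrite !flipk -/X -/Z in lZ.
have nP1 : nx P' x (x ^! i).
  apply: nP' => //; apply/eqP=> -[].
    by move/esym/eqP; rewrite (negPf (flip_neq _ _)).
  move=> /ffunP/(_ l); rewrite !flipE eqxx (negPf li); by case: (x l).
have [s1 [s2 EP']] := elimT (nxP _ _ _) nP1.
pose fin q := s1 ++ x :: q ++ x ^! i :: s2.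
have finN q q' : q != q' -> fin q != fin q'.
  by move=> h; rewrite /fin -(cat_rcons x s1 (q ++ _)) -(cat_rcons x s1 (q' ++ _)) cat_neq.
have SXF c : (subc F u c : nat) = subc F' u c + subc F' X c.
  by rewrite SX (subc_split _ _ kF).
(* Extended by [X] and [X ^! i] at its ends, the ring path misses just [Z] and [Z ^! i], which [P']
   already visits. The direction of its second step, [q1] or [q2], distinguishes the two results. *)
suff H r : ring_path i j l F' X [:: X ^! j & r] ->
    HPm m F u v (fin (X :: X ^! j :: r ++ [:: X ^! i])).
  have [q1 q1F] := @pick_notin _ F' [:: i; j; l] (leq_trans (isT : 3 < 5) F5).
  rewrite !inE !negb_or => /and3P[q1i q1j q1l].
  have [q2 q2F] := @pick_notin _ F' [:: i; j; l; q1] F5.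
  rewrite !inE !negb_or => /and4P[q2i q2j q2l q21].
  have [r1 h1] := ring_path_second X ij il jl iF jF lF q1F q1i q1j q1l.
  have [r2 h2] := ring_path_second X ij il jl iF jF lF q2F q2i q2j q2l.
  exists (fin (X :: X ^! j :: (X ^! j ^! q1 :: r1) ++ [:: X ^! i])),
         (fin (X :: X ^! j :: (X ^! j ^! q2 :: r2) ++ [:: X ^! i])); split; [|exact: H..].
  by apply: finN; apply: contraNneq q21 => -[/flip_dir->].
case=> [pr cr lr]; set R := X ^! j :: r in pr cr lr *.
have -> : X :: X ^! j :: r ++ [:: X ^! i] = X :: R ++ [:: X ^! i] by [].
set q := X :: R ++ _.
have pq : pth X (X ^! i) q.
  apply: pth_cons (adj_flip X j) _; apply: pth_cat pr _ (_ : adj _ (X ^! i)).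
    by rewrite /= !eqxx.
  by rewrite flipC adj_flipr.
have cq c : count_mem c q + ((c == Z) + (c == Z ^! i)) = subc F' X c.
  rewrite -cr /q -cat1s !count_cat [count_mem _ [:: X]]/= [count_mem _ [:: _]]/=.
  rewrite [X == _]eq_sym [X ^! i == _]eq_sym /Z; blia.
split.
- rewrite EP' in pP'; apply: pth_splice pP' pq (adj_flip _ _) _.
  by rewrite /X -flipk adj_flipr.
- move=> c; rewrite /fin count_splice -EP' cP' cP eZ flipk eZ SXF -cq; blia.
- move=> c t /split_side/orP[sc|sc] mt.
    have L : lnk P' c (c ^! t).
      have N : (c, c ^! t) != (z, z ^! i) /\ (c, c ^! t) != (z ^! i, z).
        split; apply/eqP=> -[e1 e2]; case/negP: mz.
          by move: e2; rewrite e1 => /flip_dir<-; rewrite -e1.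
        by rewrite -msym; move: e2; rewrite e1 -{2}(flipK z i) => /flip_dir e; rewrite -e1 -e.
      have [N1 N2] := N.
      have := lP c t sc mt; case/orP=> h; apply/orP; [left|right]; apply: nP' => //.
        by apply: contraNneq N2 => -[-> ->].
      by apply: contraNneq N1 => -[-> ->].
    have nm := unmatchedP uxy erefl.
    apply: lnk_splice; first by rewrite -EP'.
      by apply/eqP=> -[e1]; rewrite e1 => /flip_dir e2; rewrite e1 e2 nm in mt.
    apply/eqP=> -[e1 e2].
    have it : i = t by apply: (@flip_dir _ x); rewrite -e2 -e1 flipK.
    by move: mt; rewrite -msym e1 -it nm.
  rewrite -SX in sc.
  case: (eqVneq t i) => [e|ti]; last first.
    have [-> h] := almost_only At mF mu mv sc mt ti; apply: lnk_splice_new; move: h.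
    have q1 : lnk q X (X ^! j) by rewrite /lnk nx_cons2 !eqxx.
    have q2 : lnk q (X ^! i) (X ^! i ^! j).
      have [r' [eR _ lR]] := elimT (pthP _ _ _) pr.
      rewrite lnkC (flipC X i j) /lnk; apply/orP; left; apply/nxP.
      by exists (X :: belast (X ^! j) r'), [::]; rewrite /q eR (lastI (X ^! j)) lR cat_rcons.
    by rewrite !inE => /or4P[] /eqP->; rewrite ?flipK // lnkC.
  rewrite {}e in mt *.
  have mj x' : m x' j -> c = x' -> False.
    by move=> mx e; move: ij; rewrite -(mfun mt (t' := j)) ?eqxx // e.
  case: (boolP (c \in [:: Z; Z ^! i])) => [|cZ].
    have Zk : Z k = ~~ x k by rewrite !flipE eqxx [k == l]eq_sym (neq_k lF) addbF addbT.
    have L : lnk (fin q) Z (Z ^! i).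
      apply: lnk_splice; first by rewrite -EP'.
        by apply/eqP=> -[/ffunP/(_ k)]; rewrite Zk; case: (x k).
      apply/eqP=> -[/ffunP/(_ k)]; rewrite [_ k]flipE Zk [k == i]eq_sym (neq_k iF) addbF.
      by case: (x k).
    by rewrite !inE => /orP[] /eqP->; rewrite ?flipK // lnkC.
  apply: lnk_splice_new; apply: (@lnk_mono _ [:: X]); apply: lr => //.
  move: cZ; rewrite !inE !negb_or => /andP[-> ->] /=; apply/and4P; split;
    apply/eqP; apply: mj => //; rewrite ?msym // flipC msym //.
Qed.

Lemma two_same u v : subc F' u v -> parity u != parity v -> ~~ bad F u v -> two F u v.
Proof.
move=> sv puv nb.
case: (boolP (c1 F' u v)) => [|n1]; first exact: two_same_c1.
case: (boolP (c2 F' u v)) => [|n2]; first exact: two_same_c2.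
have n3 : ~~ c3 u v by move: nb; rewrite /bad !negb_or => /and3P[].
have [|P [P' [nP hP hP']]] := IH sv puv; first by rewrite /bad !negb_or n1 n2.
(* Either a detour or [two_shadow_c2] gives two paths, or the edge opposite to each unmatched edge
   of [Q] is matched, so that [Q] alternates between the matchings of the two sides. *)
have key Q : HPm m F' u v Q -> two F u v \/ alternates m (fun z t => m (z ^! k) t) Q.
  move=> hQ; have [pQ _ _] := hQ.
  have inQ x : x \in Q = subc F' u x by apply: HPm_mem hQ.
  case: (boolP [exists a, exists b, [&& nx Q a b, unmatched a b & ~~ bad F' (a ^! k) (b ^! k)]]).
    move=> /existsP[a /existsP[b /and3P[nab uab gab]]]; left.
    have [as_ bs _] := nx_index (HPm_uniq hQ) nab; rewrite !inQ in as_ bs.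
    have [||r [r' [nr hr hr']]] := IH _ _ gab.
    - by rewrite subc_flip2 -(subc_eql as_).
    - by have /adjP[t ->] := nx_adj pQ nab; rewrite !parity_flip; case: parity.
    have [s1 [s2 E]] := elimT (nxP _ _ _) nab; rewrite E in hQ.
    have um t : b = a ^! t -> m a t = false by apply: unmatchedP.
    exists (s1 ++ a :: r ++ b :: s2), (s1 ++ a :: r' ++ b :: s2); split.
    - by rewrite -(cat_rcons a s1 (r ++ _)) -(cat_rcons a s1 (r' ++ _)) cat_neq.
    - exact: HPm_splice kF mk um msym hQ hr.
    - exact: HPm_splice kF mk um msym hQ hr'.
  rewrite negb_exists => /forallP nall.
  have allbad a b : nx Q a b -> unmatched a b -> bad F' (a ^! k) (b ^! k).
    move=> h1 h2; move: (nall a); rewrite negb_exists => /forallP/(_ b).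
    by rewrite h1 h2 /= negbK.
  case: (boolP [exists a, exists b, [&& nx Q a b, unmatched a b & c2 F' (a ^! k) (b ^! k)]]).
    move=> /existsP[a /existsP[b /and3P[nab uab cab]]]; left.
    exact: two_shadow_c2 hQ nab uab cab allbad.
  rewrite negb_exists => /forallP no2; right=> a b nab.
  have /adjP[t e] := nx_adj pQ nab; exists t => //.
  case: (boolP (m a t)) => //= nm.
  have uab : unmatched a b by rewrite e unmatched_flip.
  have /or3P[/existsP[i /andP[+ h]]|h|/existsP[i /andP[/eqP + h]]] := allbad _ _ nab uab.
  (* C1 matches [a ^! k] along [i] and makes the two ends differ at [i]. They differ only at [t], so
     the edge between them is matched. *)
  - have mi := halfP _ _ _ _ h _ (subc_refl _ _) erefl.
    rewrite cls_eq; last by rewrite e !parity_flip; case: parity.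
    rewrite e (flipC a t k) [in X in _ != X]flipE; case: (eqVneq i t) => [<-//|_].
    by rewrite addbF eqxx.
  - by move: (no2 a); rewrite negb_exists => /forallP/(_ b); rewrite nab uab h.
  - by rewrite e (flipC a t k) => /flip_dir->.
case: (key P hP) => // aP; case: (key P' hP') => // aP'.
by case/eqP: nP; apply: (alternating_unique mfun _ hP hP' aP aP') => z t t'; apply: mfun.
Qed.

Lemma two_step u v : subc F u v -> parity u != parity v -> ~~ bad F u v -> two F u v.
Proof.
move=> suv puv nb; case: (eqVneq (v k) (u k)) => vk; last exact: two_opposite.
by apply: two_same => //; apply: subc_D1I.
Qed.

End Step.
End Matching.

(** Induction on the number of free directions: [two_step] adds a direction of [F] outside [D], in
    which there is no matched edge. *)
Lemma two_extend n (m : cube n -> 'I_n -> bool) (D F : {set 'I_n}) :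
  (forall z t, m (z ^! t) t = m z t) -> (forall z t t', m z t -> m z t' -> t = t') ->
  (forall z t, m z t -> t \in D) -> 5 <= #|D| -> D \subset F ->
  (forall u v, subc D u v -> parity u != parity v -> ~~ bad m D u v -> two m D u v) ->
  forall u v, subc F u v -> parity u != parity v -> ~~ bad m F u v -> two m F u v.
Proof.
move=> msym mfun mD D5 + base; move: {2}#|F| (leqnn #|F|) => N.
elim: N F => [|N IH] F FN DF.
  by move: (leq_trans (subset_leq_card DF) FN); lia.
case: (eqVneq D F) => [<-//|ne].
have /properP[_ [k kF kD]] : D \proper F by rewrite properEneq ne.
have DF' : D \subset F :\ k by rewrite subsetD1 DF.
apply: (two_step msym mfun kF).
- by move=> z t /mD; apply: (subsetP DF').
- exact: leq_trans D5 (subset_leq_card DF').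
- by apply: IH => //; move: FN; rewrite (cardsD1 k) kF.
Qed.

(** * Necessity of the failure of C1 to C3 *)

Section Necessity.
Variables (n : nat) (m : cube n -> 'I_n -> bool) (u v : cube n) (s : seq (cube n)).
Hypothesis n5 : 5 <= n.
Hypothesis hs : HPm m setT u v s.
Implicit Types (x y z w : cube n) (i j l t : 'I_n).

Let us : uniq s. Proof. exact: HPm_uniq hs. Qed.

Lemma subcT (c z : cube n) : subc setT c z.
Proof. by apply/subcP=> t; rewrite inE. Qed.

Let alls z : z \in s. Proof. by rewrite (HPm_mem z hs) subcT. Qed.

Let lm z t : m z t -> lnk s z (z ^! t).
Proof. by case: hs => _ _ h; apply: h; rewrite subcT. Qed.

Let lu a b : lnk s u a -> lnk s u b -> a = b.
Proof. by case: hs us => /pthP[s' [-> _ _]] _ _; apply: lnk_head. Qed.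

Let lv a b : lnk s v a -> lnk s v b -> a = b.
Proof. by case: hs us => /pthP[s' [-> _ <-]] _ _; apply: lnk_last. Qed.

Lemma other_dir (r : seq 'I_n) : size r < 5 -> exists l, l \notin r.
Proof.
move=> h; have [|l _ lr] := @pick_notin _ [set: 'I_n] r; last by exists l.
by rewrite cardsT card_ord (leq_trans h).
Qed.

(** The path is connected, so a closed set containing [u] is the whole cube, which has at least 32
    vertices. *)
Lemma not_closed (A : seq (cube n)) : size A <= 4 -> u \in A ->
  (forall a b, a \in A -> lnk s a b -> b \in A) -> False.
Proof.
move=> A4 uA cl.
have sub z : z \in A.
  by case: hs (alls z) => /pthP[s' [e _ _]] _ _; rewrite e; apply: closed_lnk => //; rewrite -e.
have : #|{: cube n}| <= 4.
  by apply: leq_trans A4; rewrite cardE uniq_leq_size ?enum_uniq.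
rewrite card_ffun card_bool card_ord leqNgt => /negP[].
by apply: leq_trans (_ : 2 ^ 5 <= _) => //; rewrite leq_exp2l.
Qed.

(** [W i] and [Z i] split the side of [u] in direction [i] by class. Flipping another direction
    exchanges them, so they have the same size. *)
Let W i := [set w : cube n | (w i == u i) && (cls i w != cls i u)].
Let Z i := [set z : cube n | (z i == u i) && (cls i z == cls i u)].

Let cardWZ i : #|W i| = #|Z i|.
Proof.
have [l] := other_dir (isT : size [:: i] < 5); rewrite inE => li.
rewrite -(card_imset (Z i) (@flip_inj _ l)); congr #|pred_of_set _|.
have il : i != l by rewrite eq_sym.
apply/setP=> w; apply/idP/imsetP => [|[z + ->]].
  rewrite inE => /andP[w1 w2]; exists (w ^! l); last by rewrite flipK.
  by rewrite inE flipE (negPf il) addbF w1 cls_flip //; case: cls w2; case: cls.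
by rewrite !inE flipE (negPf il) addbF cls_flip // => /andP[-> /eqP->]; case: cls.
Qed.

(** A vertex of [W i] is an inner vertex of the path, so one of its two path edges stays on the side
    and leads to [Z i]. No vertex of [Z i] is reached twice: an end has a single neighbour, and any
    other vertex spends one of its two on direction [i]. Equal sizes then make the map onto. *)
Lemma inner_neighbour i : v \notin W i ->
  (forall z, cls i z = cls i u -> z != u -> z != v -> lnk s z (z ^! i)) ->
  exists g : cube n -> cube n, [/\ forall w, w \in W i -> lnk s w (g w),
    {in W i &, injective g} & g @: W i = Z i].
Proof.
move=> vW lz.
have uW : u \notin W i by rewrite inE !eqxx.
have ex w : w \in W i -> exists t, (t != i) && lnk s w (w ^! t).
  move=> wW.
  have wu : w != u by apply: contraNneq uW => <-.
  have wv : w != v by apply: contraNneq vW => <-.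
  have ps : pth u v s by case: hs.
  have [a [b [na nb]]] := pth_interior ps (alls w) wu wv.
  have [ta ea] := elimT (adjP _ _) (nx_adj ps na).
  have [tb eb] := elimT (adjP _ _) (nx_adj ps nb).
  have {}ea : a = w ^! ta by rewrite ea flipK.
  case: (eqVneq ta i) => [e|h]; last by exists ta; rewrite h -ea /lnk na orbT.
  case: (eqVneq tb i) => [e'|h]; last by exists tb; rewrite h -eb /lnk nb.
  by move: (nx_asym us na); rewrite ea e -e' -eb nb.
pose g w := if [pick t | (t != i) && lnk s w (w ^! t)] is Some t then w ^! t else w.
have gP w : w \in W i -> lnk s w (g w) /\ g w \in Z i.
  move=> wW; rewrite /g; case: pickP => [t /andP[ti L]|no]; last first.
    by have [t] := ex w wW; rewrite no.
  split=> //; move: wW; rewrite !inE => /andP[h1 h2].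
  rewrite flipE eq_sym [i == t]eq_sym (negPf ti) addbF eq_sym h1 cls_flip 1?eq_sym //.
  by case: cls h2; case: cls.
have gI : {in W i &, injective g}.
  move=> w w' hw hw' e.
  have [L gZ] := gP _ hw; have [L' _] := gP _ hw'.
  rewrite -e lnkC in L'; rewrite lnkC in L.
  case: (eqVneq (g w) u) L L' => [->|gu] L L'; first exact: lu L L'.
  case: (eqVneq (g w) v) L L' => [->|gv] L L'; first exact: lv L L'.
  move: gZ; rewrite inE => /andP[/eqP gi /eqP gc].
  have ne x : x \in W i -> g w ^! i != x.
    rewrite inE => /andP[/eqP xi _]; apply/eqP => /ffunP/(_ i).
    by rewrite flipE eqxx gi xi; case: (u i).
  exact: lnk_le2 us (lz _ gc gu gv) L L' (ne _ hw) (ne _ hw').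
exists g; split=> // [w /gP[]//|].
apply/eqP; rewrite eqEcard card_in_imset // cardWZ leqnn andbT.
by apply/subsetP=> z /imsetP[w /gP[_ h] ->].
Qed.

(** As an image, [u] has a path neighbour in [W i]; but its single path edge is the matched one in
    direction [i], which leaves the side. *)
Lemma hamilton_not_c1 : ~~ c1 m setT u v.
Proof.
apply/negP=> /existsP[i /andP[/eqP e /halfP h]].
have [|z cz _ _|g [gl gI gW]] := @inner_neighbour i.
- by rewrite inE e eqxx andbF.
- by apply/lm/h; rewrite ?subcT.
have : u \in g @: W i by rewrite gW inE !eqxx.
case/imsetP=> w wW ew; have := gl w wW; rewrite -ew lnkC => L.
have L' : lnk s u (u ^! i) by apply/lm/h; rewrite ?subcT.
by move: wW; rewrite (lu L L') inE flipE eqxx; case: (u i).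
Qed.

(** The single path edges of [u] and [v] go along [j]. Counting forces the path to step between
    [u ^! j] and [v ^! j], so these four vertices are closed under adjacency on the path. *)
Lemma hamilton_not_c2 : ~~ c2 m setT u v.
Proof.
apply/negP=> /existsP[i /existsP[j /and5P[ij /eqP e /almostP A mu mv]]].
have vi : v i != u i by rewrite e flipE eqxx; case: (u i).
have [|z cz zu zv|g [gl gI gW]] := @inner_neighbour i.
- by rewrite inE (negPf vi).
- by apply/lm/A; rewrite ?subcT // -e.
have Lu := lm mu; have Lv := lm mv.
have uW : u \in g @: W i by rewrite gW inE !eqxx.
have {uW}[w0 w0W ew0] := imsetP uW; have L0 := gl w0 w0W.
rewrite -ew0 lnkC in L0; have e0 := lu L0 Lu; rewrite {}e0 {L0} in w0W ew0.
have Luv : lnk s (u ^! j) (v ^! j).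
  have nuv : u ^! j != v.
    by apply/eqP => h; move: vi; rewrite -h flipE (negPf ij) addbF eqxx.
  have ps : pth u v s by case: hs.
  have [a [b [na nb]]] := pth_interior ps (alls _) (flip_neq u j) nuv.
  (* A neighbour in a direction other than [i] lies in [Z i], where its only path neighbour in [W i]
     is its preimage; but [u ^! j] is the preimage of [u]. *)
  have claim x : lnk s (u ^! j) x -> x != u -> x = v ^! j.
    move=> L xu.
    have /adjP[t et] : adj (u ^! j) x.
      case/orP: L => /(nx_adj ps) // /adjP[t et]; apply/adjP; exists t; by rewrite et flipK.
    case: (eqVneq t i) => [eti|ti]; first by rewrite et eti e flipC.
    have xZ : x \in Z i.
      rewrite inE et !flipE (negPf ij) [i == t]eq_sym (negPf ti) !addbF eqxx.
      by rewrite !cls_flip ?negbK ?eqxx // eq_sym.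
    have xv : x != v.
      by move: xZ; rewrite inE => /andP[xi _]; apply: contraNneq vi => <-.
    move: (xZ); rewrite -gW => /imsetP[w wW ew]; have Lw := gl w wW.
    rewrite -ew lnkC in Lw; rewrite lnkC in L.
    have Lx : lnk s x (x ^! i).
      by move: xZ; rewrite inE => /andP[_ /eqP cx]; apply/lm/A; rewrite ?subcT // -e.
    have ne y : y \in W i -> x ^! i != y.
      move: xZ; rewrite !inE => /andP[/eqP xi _] /andP[/eqP yi _]; apply/eqP => /ffunP/(_ i).
      by rewrite flipE eqxx xi yi; case: (u i).
    have ew' := lnk_le2 us Lx Lw L (ne _ wW) (ne _ w0W).
    by move: xu; rewrite ew ew' -ew0 eqxx.
  case: (eqVneq a u) => [eau|nau]; last by rewrite -(claim a) // /lnk na orbT.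
  rewrite -(claim b) /lnk ?nb //; apply: contraTneq nb => ->.
  by rewrite eau in na; apply: nx_asym.
apply: (@not_closed [:: u; u ^! j; v ^! j; v]) => //; first by rewrite inE eqxx.
have Lu' : lnk s (u ^! j) u by rewrite lnkC.
have Lv' : lnk s (v ^! j) v by rewrite lnkC.
have Lvu : lnk s (v ^! j) (u ^! j) by rewrite lnkC.
have nuv : u != v ^! j by apply/eqP=> h; move: vi; rewrite h flipE (negPf ij) addbF eqxx.
have nvu : v != u ^! j by apply/eqP=> h; move: vi; rewrite h flipE (negPf ij) addbF eqxx.
move=> a b; rewrite !inE => /or4P[]/eqP-> L.
- by rewrite (lu L Lu) eqxx orbT.
- case: (eqVneq u b) => //= ub.
  by rewrite -(lnk_le2 us Lu' Luv L nuv ub) eqxx !orbT.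
- case: (eqVneq v b) => [_|vb]; first by rewrite !orbT.
  by rewrite -(lnk_le2 us Lv' Lvu L nvu vb) eqxx !orbT.
- by rewrite (lv L Lv) eqxx !orbT.
Qed.

Lemma hamilton_not_c3 : ~~ c3 m u v.
Proof.
apply/negP=> /existsP[i /andP[/eqP e mu]]; have L := lm mu; rewrite -e in L.
have L' : lnk s v u by rewrite lnkC.
apply: (@not_closed [:: u; v]) => //; first by rewrite inE eqxx.
move=> a b; rewrite !inE => /orP[]/eqP-> h; first by rewrite (lu h L) eqxx orbT.
by rewrite (lv h L') eqxx.
Qed.

Lemma hamilton_not_bad : ~~ bad m setT u v.
Proof. by rewrite /bad !negb_or hamilton_not_c1 hamilton_not_c2 hamilton_not_c3. Qed.

End Necessity.

(** * Matchings as sets of edges and as relations *)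

Section Matchings.
Variable n : nat.
Implicit Types (x y z u v a b : cube n) (i j t : 'I_n) (M : {set {set cube n}}).
Implicit Types (s : seq (cube n)).

Definition edge_of M x i := edge_in x i \in M.

Lemma edge_in_flip x i : edge_in (x ^! i) i = edge_in x i.
Proof. by rewrite /edge_in flipK setUC. Qed.

Lemma edge_of_flip M x i : edge_of M (x ^! i) i = edge_of M x i.
Proof. by rewrite /edge_of edge_in_flip. Qed.

Lemma mem_edge_in y x i : (y \in edge_in x i) = (y == x) || (y == x ^! i).
Proof. by rewrite !inE. Qed.

Lemma edge_in_mem y x i : y \in edge_in x i -> edge_in x i = edge_in y i.
Proof. by rewrite mem_edge_in => /orP[]/eqP->; rewrite ?edge_in_flip. Qed.

Lemma edge_in_dir x i j : edge_in x i = edge_in x j -> i = j.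
Proof.
move=> e; have : x ^! i \in edge_in x j by rewrite -e mem_edge_in eqxx orbT.
by rewrite mem_edge_in (negPf (flip_neq _ _)) => /eqP/flip_dir.
Qed.

Lemma pair_eq x y a b : x != y -> [set x; y] = [set a; b] ->
  (x = a /\ y = b) \/ (x = b /\ y = a).
Proof.
move=> xy e.
have : x \in [set a; b] by rewrite -e !inE eqxx.
have : y \in [set a; b] by rewrite -e !inE eqxx orbT.
rewrite !inE => /orP[]/eqP ey /orP[]/eqP ex; [|by right|by left|];
  by rewrite ex ey eqxx in xy.
Qed.

Lemma edge_of_fun M x i j : matching M -> edge_of M x i -> edge_of M x j -> i = j.
Proof.
move=> [_ /trivIsetP tM] hi hj; case: (eqVneq i j) => // ij.
have /(tM _ _ hi hj)/disjoint_setI0/setP/(_ x) : edge_in x i != edge_in x j.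
  by apply: contraNneq ij => /edge_in_dir->.
by rewrite !inE eqxx.
Qed.

Lemma edge_of_dir M x i : edge_of M x i -> i \in directions M.
Proof.
move=> h; rewrite inE; apply/existsP; exists x; apply/existsP; exists (x ^! i).
by rewrite adj_flip flipE eqxx -/(edge_in x i) -/(edge_of M x i) h; case: (x i).
Qed.

(** Both ends of the edge have the same class, and for the end whose coordinate [i] is zero the
    class is the parity. *)
Lemma edge_in_half_layer x i p : (edge_in x i \in half_layer i p) = (cls i x == p).
Proof.
apply/imsetP/eqP => [[y + /esym]|<-].
  rewrite inE => /andP[yi /eqP <-] e.
  have : x \in edge_in y i by rewrite e mem_edge_in eqxx.
  by rewrite mem_edge_in => /orP[]/eqP->; rewrite ?cls_flip_same /cls (negPf yi) addbF.
case: (boolP (x i)) => xi.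
  exists (x ^! i); last by rewrite edge_in_flip.
  by rewrite inE flipE eqxx xi parity_flip /cls xi !addbT /= eqxx.
by exists x => //; rewrite inE xi /cls (negPf xi) addbF eqxx.
Qed.

Lemma half_layer_edge E i p : E \in half_layer i p -> exists x, E = edge_in x i.
Proof. by case/imsetP=> x _ ->; exists x. Qed.

Lemma covered_half_layer x i p : covered x (half_layer i p) <-> cls i x = p.
Proof.
split=> [[E hE xE]|h]; last first.
  by exists (edge_in x i); [rewrite edge_in_half_layer h|rewrite mem_edge_in eqxx].
have [y e] := half_layer_edge hE; rewrite {}e in hE xE.
by apply/eqP; rewrite -edge_in_half_layer -(edge_in_mem xE).
Qed.

Lemma condC1E M u v : condC1 M u v <-> c1 (edge_of M) setT u v.
Proof.
split=> [[i [p [/subsetP hp /covered_half_layer hu /covered_half_layer hv]]]|].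
  apply/existsP; exists i; rewrite hu hv eqxx /=; apply/halfP => z _ cz.
  by apply: hp; rewrite edge_in_half_layer cz.
move=> /existsP[i /andP[/eqP e /halfP h]]; exists i, (cls i u); split.
- apply/subsetP=> E hE; have [x ex] := half_layer_edge hE; rewrite {}ex in hE *.
  by apply: h; [exact: subcT|apply/eqP; rewrite -edge_in_half_layer].
- exact/covered_half_layer.
- exact/covered_half_layer.
Qed.

Lemma condC2E M u v : condC2 M u v <-> c2 (edge_of M) setT u v.
Proof.
split=> [[i [j [ij e [A [p hp EA] AM] [mu mv]]]]|].
  apply/existsP; exists i; apply/existsP; exists j; rewrite ij e eqxx /edge_of mu -e mv !andbT.
  apply/almostP=> z _ cz zu zv; apply: (subsetP AM); rewrite EA in_setD1.
  move: hp; rewrite !edge_in_half_layer cz => ->; rewrite andbT.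
  apply/eqP=> h; have : z \in edge_in u i by rewrite -h mem_edge_in eqxx.
  by rewrite mem_edge_in (negPf zu) (negPf zv).
move=> /existsP[i /existsP[j /and5P[ij /eqP e /almostP h mu mv]]].
exists i, j; split=> //; exists (half_layer i (cls i u) :\ edge_in u i).
  by exists (cls i u); rewrite ?edge_in_half_layer.
apply/subsetP=> E; rewrite in_setD1 => /andP[nE hE].
have [x ex] := half_layer_edge hE; rewrite {}ex in nE hE *.
apply: h; first exact: subcT.
- by apply/eqP; rewrite -edge_in_half_layer.
- by apply: contraNneq nE => ->.
- by apply: contraNneq nE => ->; rewrite edge_in_flip.
Qed.

Lemma cube_edgesP E : reflect (exists x i, E = edge_in x i) (E \in cube_edges n).
Proof.
rewrite inE; apply: (iffP existsP) => [[x /existsP[y /andP[/adjP[i ->] /eqP->]]]|[x [i ->]]].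
  by exists x, i.
by exists x; apply/existsP; exists (x ^! i); rewrite adj_flip /=.
Qed.

(** A member of the matching is a cube edge, so [v] is a flip of [u]; opposite parity ensures that
    the set has two elements. *)
Lemma condC3E M u v : matching M -> parity u != parity v ->
  condC3 M u v <-> c3 (edge_of M) u v.
Proof.
move=> [sM _] puv; split=> [h|/existsP[i /andP[/eqP-> h]]//].
have uv : u != v by apply: contraNneq puv => ->.
have /cube_edgesP[x [i e]] := subsetP sM _ h.
have {}e : [set u; v] = edge_in u i.
  by rewrite e; apply: edge_in_mem; rewrite -e !inE eqxx.
have [[_ ev]|[eu _]] := pair_eq uv e.
  by apply/existsP; exists i; rewrite ev eqxx /edge_of -e.
by move: (flip_neq u i); rewrite -eu eqxx.
Qed.

Lemma no_cond M u v : matching M -> parity u != parity v ->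
  ([/\ ~ condC1 M u v, ~ condC2 M u v & ~ condC3 M u v]
   <-> ~~ bad (edge_of M) setT u v).
Proof.
move=> hM puv; have [h1 h1'] := condC1E M u v; have [h2 h2'] := condC2E M u v.
have [h3 h3'] := condC3E hM puv.
rewrite /bad !negb_or; split=> [[n1 n2 n3]|/and3P[/negP n1 /negP n2 /negP n3]].
  by apply/and3P; split; apply/negP; [move/h1'|move/h2'|move/h3'].
by split; [move/h1|move/h2|move/h3].
Qed.

Lemma mem_path_edges x y s : x != y -> ([set x; y] \in path_edges s) = lnk s x y.
Proof.
move=> xy; rewrite inE; apply/mapP/idP => [[[a b] h /= e]|].
  by have [[-> ->]|[-> ->]] := pair_eq xy e; rewrite /lnk /nx h ?orbT.
by case/orP=> h; [exists (x, y)|exists (y, x)] => //=; rewrite setUC.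
Qed.

Lemma hamilton_pathE M a b s : matching M ->
  (hamilton_path a b s /\ M \subset path_edges s) <-> HPm (edge_of M) setT a b s.
Proof.
move=> [sM _]; split=> [[[h1 h2 h3 h4 h5] h6]|[/pthP[s' [es ps ls]] cs hl]].
  split.
  - move: h1 h2 h3 (h5 a); case: (s) => //= c s' -> -> -> _.
    by rewrite !eqxx.
  - by move=> z; rewrite subcT count_uniq_mem // h5.
  - move=> z t _ h; rewrite -mem_path_edges ?(subsetP h6) //.
    by rewrite eq_sym flip_neq.
have us : uniq s by apply: count_pred_uniq cs.
split.
  by split=> // [|||x]; rewrite ?(count_pred_mem cs) ?subcT // es.
apply/subsetP=> E hE; have /cube_edgesP[x [i e]] := subsetP sM _ hE; rewrite {}e in hE *.
by rewrite mem_path_edges ?hl ?subcT // eq_sym flip_neq.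
Qed.

End Matchings.

(** * Transport between [Q_d] and a subcube of [Q_n] *)

Section Transport.
Variables (d n : nat) (e : 'I_d -> 'I_n) (D : {set 'I_n}) (c : cube n).
Hypothesis einj : injective e.
Hypothesis eD : forall t, reflect (exists i, t = e i) (t \in D).
Implicit Types (w a b : cube d) (i j : 'I_d) (z : cube n).

(** Addition of [w] to the base point [c] along the directions [e i]; as [e] is injective, at most
    one index contributes to each coordinate. *)
Definition emb w : cube n := [ffun t => c t (+) [exists i, (e i == t) && w i]].
Definition unemb z : cube d := [ffun i => z (e i) (+) c (e i)].

Lemma emb_in w i : emb w (e i) = c (e i) (+) w i.
Proof.
rewrite ffunE; congr addb; apply/existsP/idP => [[j /andP[/eqP/einj->]]//|h].
by exists i; rewrite eqxx.
Qed.

Lemma emb_out w t : t \notin D -> emb w t = c t.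
Proof.
move=> tD; rewrite ffunE; case: existsP => [[i /andP[/eqP h _]]|_]; last by rewrite addbF.
by case/eD: tD; exists i.
Qed.

Lemma emb_flip w i : emb (w ^! i) = emb w ^! e i.
Proof.
apply/ffunP=> t; rewrite flipE; case: (boolP (t \in D)) => [/eD[j ->]|tD].
  by rewrite !emb_in flipE (inj_eq einj) addbA.
rewrite !emb_out //; case: eqP => [h|_]; last by rewrite addbF.
by case/eD: tD; exists i.
Qed.

Lemma unembK w : unemb (emb w) = w.
Proof. by apply/ffunP=> i; rewrite ffunE emb_in addbC addbA addbb. Qed.

Lemma emb_inj : injective emb. Proof. exact: can_inj unembK. Qed.

Lemma embK z : subc D c z -> emb (unemb z) = z.
Proof.
move=> /subcP h; apply/ffunP=> t; case: (boolP (t \in D)) => [/eD[j ->]|tD].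
  by rewrite emb_in ffunE addbCA addbb addbF.
by rewrite emb_out // h.
Qed.

Lemma subc_emb w : subc D c (emb w).
Proof. by apply/subcP=> t; apply: emb_out. Qed.

(** Each one of [w] amounts to one flip of [c], hence the induction on their number. *)
Lemma parity_emb w : parity (emb w) = parity c (+) parity w.
Proof.
move: {2}#|[set i | w i]| (erefl #|[set i | w i]|) => N.
elim: N w => [|N IH] w.
  move/eqP; rewrite cards_eq0 => /eqP h.
  have -> : parity w = false by rewrite /parity h cards0.
  rewrite addbF; congr parity; apply/ffunP=> t; rewrite ffunE.
  case: existsP => [[i /andP[_ wi]]|_]; last by rewrite addbF.
  by move/setP/(_ i): h; rewrite !inE wi.
move=> hN; have [i wi] : exists i, i \in [set i | w i] by apply/card_gt0P; rewrite hN.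
rewrite -{1}(flipK w i) emb_flip parity_flip IH ?parity_flip ?addbN ?negbK //.
move: hN; rewrite (cardsD1 i) wi add1n => -[<-]; congr #|pred_of_set _|.
apply/setP=> j; rewrite !inE flipE; rewrite inE in wi.
by case: eqP => [->|_]; rewrite ?wi ?addbF.
Qed.

Lemma cls_emb i w : cls (e i) (emb w) = cls (e i) c (+) cls i w.
Proof. by rewrite /cls parity_emb emb_in addbACA. Qed.

Variable m : cube n -> 'I_n -> bool.
Hypothesis msym : forall z t, m (z ^! t) t = m z t.
Hypothesis mfun : forall z t t', m z t -> m z t' -> t = t'.
Hypothesis mD : forall z t, m z t -> t \in D.

Definition pullback : {set {set cube d}} :=
  [set E | [exists w, exists i, (E == edge_in w i) && m (emb w) (e i)]].

Lemma edge_of_pullback w i : edge_of pullback w i = m (emb w) (e i).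
Proof.
rewrite /edge_of inE; apply/existsP/idP => [[w' /existsP[j /andP[/eqP E h]]]|h]; last first.
  by exists w; apply/existsP; exists i; rewrite eqxx.
have ww : w \in edge_in w' j by rewrite -E mem_edge_in eqxx.
have ij : i = j by apply: (@edge_in_dir _ w); rewrite E; apply: edge_in_mem.
move: ww; rewrite mem_edge_in ij => /orP[]/eqP-> //.
by rewrite emb_flip msym.
Qed.

Lemma matching_pullback : matching pullback.
Proof.
have P E : E \in pullback -> exists w i, E = edge_in w i /\ m (emb w) (e i).
  by rewrite inE => /existsP[w /existsP[i /andP[/eqP-> h]]]; exists w, i.
split.
  by apply/subsetP=> E /P[w [i [-> _]]]; apply/cube_edgesP; exists w, i.
apply/trivIsetP=> A B /P[w [i [-> hA]]] /P[w' [i' [-> hB]]].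
apply: contraR => /pred0Pn[x /andP[/= xA xB]].
rewrite (edge_in_mem xA) (edge_in_mem xB); rewrite -!edge_of_pullback in hA hB.
rewrite /edge_of (edge_in_mem xA) -/(edge_of _ x i) edge_of_pullback in hA.
rewrite /edge_of (edge_in_mem xB) -/(edge_of _ x i') edge_of_pullback in hB.
by rewrite (einj (mfun hA hB)).
Qed.

(** Used contrapositively, to apply the hypothesis in dimension [d] to the pulled back matching. *)
Lemma bad_pullback a b : bad (edge_of pullback) setT a b -> bad m D (emb a) (emb b).
Proof.
have sa w : subc D (emb a) (emb w).
  by rewrite -(subc_eql (subc_emb a)) subc_emb.
have ex z : subc D (emb a) z -> exists w, z = emb w.
  by rewrite -(subc_eql (subc_emb a)) => /embK <-; exists (unemb z).
case/or3P=> [/existsP[i /andP[/eqP h /halfP h']]|/existsP[i /existsP[j]]|/existsP[i]].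
- apply/or3P/Or31; apply/existsP; exists (e i); rewrite !cls_emb h eqxx /=.
  apply/halfP=> z /ex[w ->]; rewrite cls_emb => /addbI cw.
  by rewrite -edge_of_pullback; apply: h'; rewrite ?subcT // h.
- move=> /and5P[ij /eqP -> /almostP A]; rewrite !edge_of_pullback => ma mb.
  apply/or3P/Or32; apply/existsP; exists (e i); apply/existsP; exists (e j).
  rewrite (inj_eq einj) ij ma mb emb_flip eqxx !andbT /=.
  apply/almostP=> z /ex[w ->]; rewrite !cls_emb => /addbI cw wa wb.
  rewrite -edge_of_pullback; apply: A; rewrite ?subcT //.
    by apply: contraNneq wa => ->.
  by apply: contraNneq wb => ->; rewrite emb_flip.
- move=> /andP[/eqP->]; rewrite edge_of_pullback => ma.
  by apply/or3P/Or33; apply/existsP; exists (e i); rewrite emb_flip eqxx.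
Qed.

Lemma nx_map (f : cube d -> cube n) s x y : nx s x y -> nx (map f s) (f x) (f y).
Proof.
move=> /nxP[s1 [s2 ->]]; apply/nxP; exists (map f s1), (map f s2).
by rewrite map_cat.
Qed.

Lemma HPm_emb a b s : HPm (edge_of pullback) setT a b s ->
  HPm m D (emb a) (emb b) (map emb s).
Proof.
case=> /pthP[s' [es ps ls]] cs hl; split.
- apply/pthP; exists (map emb s'); rewrite es /= last_map ls; split=> //.
  apply: (homo_path (e := @adj d)) ps => x y /adjP[i ->]; apply/adjP; exists (e i).
  by rewrite emb_flip.
- move=> z; rewrite -(subc_eql (subc_emb a)); case: (boolP (subc D c z)) => [/embK <-|nz].
    rewrite count_map (eq_count (a2 := pred1 (unemb z))) ?cs ?subcT // => w /=.
    by rewrite (inj_eq emb_inj).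
  by apply/count_memPn; apply: contra nz => /mapP[w _ ->]; apply: subc_emb.
- move=> z t; rewrite -(subc_eql (subc_emb a)) => /embK <- h.
  have /eD[i et] := mD h; rewrite et in h *.
  have := hl (unemb z) i; rewrite subcT edge_of_pullback => /(_ isT h).
  by rewrite -emb_flip => /orP[] /nx_map-/(_ emb) k; rewrite /lnk k ?orbT.
Qed.

End Transport.

(** * The criterion in dimension [n] *)

Lemma exists_superset (T : finType) (S : {set T}) N : #|S| <= N -> N <= #|T| ->
  exists D : {set T}, S \subset D /\ #|D| = N.
Proof.
elim: N => [|N IH] SN NT; first by exists S; split=> //; apply/eqP; rewrite -leqn0.
move: SN; rewrite leq_eqVlt => /orP[/eqP e|SN]; first by exists S.
have [D [SD cD]] := IH SN (ltnW NT).
have /set0Pn[k kD] : ~: D != set0 by rewrite -card_gt0 cardsCs setCK subn_gt0 cD.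
exists (k |: D); rewrite subsetU ?SD ?orbT // cardsU1 cD.
by move: kD; rewrite inE => ->.
Qed.

Theorem theorem7 (n d : nat) (u v : cube n) (M : {set {set cube n}})
  (hd : 5 <= d) (hdn : d <= n)
  (huv : parity u != parity v)
  (hM : matching M) (hdir : #|directions M| <= d)
  (hprop : forall (M' : {set {set cube d}}) (a b : cube d),
     matching M' -> parity a != parity b ->
     ((exists s t : seq (cube d),
         [/\ hamilton_path a b s, hamilton_path a b t,
             path_edges s != path_edges t,
             M' \subset path_edges s & M' \subset path_edges t])
      <-> [/\ ~ condC1 M' a b, ~ condC2 M' a b & ~ condC3 M' a b])) :
  (exists s : seq (cube n), hamilton_path u v s /\ M \subset path_edges s)
  <-> [/\ ~ condC1 M u v, ~ condC2 M u v & ~ condC3 M u v].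
Proof.
split=> [[s /(hamilton_pathE _ _ _ hM) hs]|].
  by apply/no_cond => //; apply: hamilton_not_bad hs; apply: leq_trans hdn.
move/no_cond => /(_ hM huv) nb.
have msym := @edge_of_flip n M; have mfun z t t' := @edge_of_fun n M z t t' hM.
(* The matching may span fewer than [d] directions; they are padded to exactly [d], so that the
   hypothesis applies to the subcubes with free directions [D]. *)
have [D [dD D5]] : exists D : {set 'I_n}, directions M \subset D /\ #|D| = d.
  by apply: exists_superset => //; rewrite card_ord.
pose e (i : 'I_d) : 'I_n := enum_val (cast_ord (esym D5) i).
have einj : injective e by move=> i j /enum_val_inj /cast_ord_inj.
have eD t : reflect (exists i, t = e i) (t \in D).
  apply: (iffP idP) => [tD|[i ->]]; last exact: enum_valP.
  exists (cast_ord D5 (enum_rank_in tD t)).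
  by rewrite /e cast_ord_comp cast_ord_id enum_rankK_in.
have mD z t : edge_of M z t -> t \in D by move/edge_of_dir; apply: (subsetP dD).
have [||s [_ [_ hs _]]] := two_extend msym mfun mD _ (subsetT D) _ (subcT u v) huv nb.
- by rewrite D5.
- move=> a b sab pab nab.
  (* With [a] as base point, both ends lie in the image of the embedding. *)
  pose f := emb e a; pose g := unemb e a.
  have ea : f (g a) = a by apply: (embK einj eD); apply: subc_refl.
  have eb : f (g b) = b by apply: (embK einj eD).
  have hM' := matching_pullback a einj eD msym mfun.
  have pg : parity (g a) != parity (g b).
    have h1 := parity_emb a einj eD (g a); have h2 := parity_emb a einj eD (g b).
    rewrite -/f ea eb in h1 h2; move: pab h1 h2.
    by case: (parity a); case: (parity b); case: (parity (g a)); case: (parity (g b)).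
  have /(hprop _ _ _ hM' pg)[s [s' [h1 h2 h3 h4 h5]]] :
      [/\ ~ condC1 (pullback e a (edge_of M)) (g a) (g b),
          ~ condC2 (pullback e a (edge_of M)) (g a) (g b)
        & ~ condC3 (pullback e a (edge_of M)) (g a) (g b)].
    apply/no_cond => //; apply: contra nab => /(bad_pullback einj eD msym).
    by rewrite -/f ea eb.
  exists (map f s), (map f s'); split.
  (* The hypothesis separates the two paths by their edge sets, so their vertex lists differ as
     well. *)
  + by apply: contraNneq h3 => /(inj_map (emb_inj einj))->.
  + have /(HPm_emb einj eD msym mD) : HPm (edge_of (pullback e a (edge_of M))) setT (g a) (g b) s
      by apply/hamilton_pathE.
    by rewrite -/f ea eb.
  + have /(HPm_emb einj eD msym mD) : HPm (edge_of (pullback e a (edge_of M))) setT (g a) (g b) s'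
      by apply/hamilton_pathE.
    by rewrite -/f ea eb.
by exists s; apply/hamilton_pathE.
Qed.
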